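(* Let $f>0$ be a function such that $\ell/f(\ell)$ is nondecreasing. Suppose that for every directed unweighted graph $G=(V,E)$ with $n$ vertices one can compute, in $T(n)$ time, for all $u,v\in V$ an approximation of the shortest-path distance $D[u,v]$ with additive error $f(D[u,v])$ (i.e., a value $D'[u,v]$ with $D[u,v]\le D'[u,v]\le D[u,v]+f(D[u,v])$). Then $\max_{1\le\ell\le n}\mathcal{M}^\star\!\left(n,n/\ell,n\mid \frac{\ell}{f(\ell)}\right)\le O(T(n))$.
   Context: $\mathcal{M}^\star(n_1,n_2,n_3\mid M)$ denotes the (best) running time for computing the Min-Plus product $C[i,j]=\min_k(A[i,k]+B[k,j])$ of an $n_1\times n_2$ matrix and an $n_2\times n_3$ matrix with integer entries in $\{0,\dots,M\}$. Word-RAM model with $O(\log n)$-bit words.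
   Formalization: The function f is additionally assumed to be bounded below by some positive constant; without this the claim fails, e.g. for f(ℓ)=2^{-ℓ}, where at ℓ=n the product's n-bit entries cannot even be written in O(T(n)) time. *)

(* Defs.v *)
From mathcomp Require Import all_boot all_order all_algebra.
From mathcomp Require Import reals.

Set Implicit Arguments.
Unset Strict Implicit.
Unset Printing Implicit Defensive.

Import Order.TTheory GRing.Theory Num.Theory.

(* Word RAM with w-bit words, random-access memory of 2 ^ w words, a read-only *)
(* input tape and a write-only output tape.  A program is a list of            *)
(* instructions, each of which costs one time unit; control leaving the        *)
(* program text means halting.  Instruction arguments are register names,      *)
(* except for the literal of [Const] and the targets [l] of jumps.             *)
Inductive binop := Add | Sub | Mul | Div | Mod | And | Or | Xor | Shl | Shr.

Inductive instr :=
| Const (r c : nat)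
| Op (o : binop) (r a b : nat)
| MemGet (r a : nat)
| MemSet (a r : nat)
| Read (r : nat)
| Write (r : nat)
| Jmp (l : nat)
| Jeq (a b l : nat)
| Jlt (a b l : nat).

Definition program := seq instr.

Record state := State {
  pc : nat;
  reg : nat -> nat;
  mem : nat -> nat;
  inp : seq nat;
  out : seq nat }.

Definition upd (g : nat -> nat) (i v : nat) : nat -> nat :=
  fun j => if j == i then v else g j.

(* Subtraction wraps around; division by 0 follows [divn] and [modn]. *)
Definition eval_binop (w : nat) (o : binop) (x y : nat) : nat :=
  (match o with
   | Add => x + y
   | Sub => x + (2 ^ w - y)
   | Mul => x * y
   | Div => x %/ y
   | Mod => x %% y
   | And => Nat.land x y
   | Or => Nat.lor x y
   | Xor => Nat.lxor x y
   | Shl => x * 2 ^ y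
   | Shr => x %/ 2 ^ y
   end) %% 2 ^ w.

Definition exec_instr (w : nat) (i : instr) (s : state) : state :=
  let: State p g m x y := s in
  match i with
  | Const r c => State p.+1 (upd g r (c %% 2 ^ w)) m x y
  | Op o r a b => State p.+1 (upd g r (eval_binop w o (g a) (g b))) m x y
  | MemGet r a => State p.+1 (upd g r (m (g a))) m x y
  | MemSet a r => State p.+1 g (upd m (g a) (g r)) x y
  | Read r => State p.+1 (upd g r (head 0 x %% 2 ^ w)) m (behead x) y
  | Write r => State p.+1 g m x (rcons y (g r))
  | Jmp l => State l g m x y
  | Jeq a b l => State (if g a == g b then l else p.+1) g m x y
  | Jlt a b l => State (if g a < g b then l else p.+1) g m x y
  end.

Definition step (w : nat) (P : program) (s : state) : state :=
  if onth P (pc s) is Some i then exec_instr w i s else s.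

Definition init (x : seq nat) : state := State 0 (fun=> 0) (fun=> 0) x [::].

(* Halted states are fixed by [step], so this bounds the halting time by t. *)
Definition computes_within (w : nat) (P : program) (x : seq nat) (t : nat)
    (y : seq nat) : Prop :=
  let s := iter t (step w P) (init x) in size P <= pc s /\ out s = y.

Definition wordlen (kappa n : nat) : nat := kappa * (trunc_log 2 n).+1.

Definition row_major (T : Type) (n m : nat) (F : 'I_n -> 'I_m -> T) : seq T :=
  [seq F i j | i <- enum 'I_n, j <- enum 'I_m].

Definition walk (V : eqType) (e : rel V) (u v : V) (p : seq V) : bool :=
  path e u p && (last u p == v).

(* [None] stands for an infinite distance. *)
Definition is_dist (V : eqType) (e : rel V) (u v : V) (D : option nat) : Prop :=
  if D is Some d then
    (exists2 p, walk e u v p & size p = d) /\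
    (forall p, walk e u v p -> d <= size p)
  else forall p, ~~ walk e u v p.

Definition additive_approx (R : realType) (f : nat -> R) (D D' : option nat) :
    Prop :=
  match D, D' with
  | Some d, Some d' => d <= d' /\ (d'%:R <= d%:R + f d)%R
  | None, None => True
  | _, _ => False
  end.

Definition dist_word (D : option nat) : nat := if D is Some d then d.+1 else 0.

Definition graph_input (n : nat) (e : rel 'I_n) : seq nat :=
  n :: row_major (fun u v => nat_of_bool (e u v)).

Definition additive_apsp_in_time (R : realType) (f : nat -> R) (T : nat -> nat) :
    Prop :=
  exists (P : program) (kappa : nat), forall (n : nat) (e : rel 'I_n),
  exists D' : 'I_n -> 'I_n -> option nat,
    (forall u v, exists2 D, is_dist e u v D & additive_approx f D (D' u v)) /\
    computes_within (wordlen kappa n) P (graph_input e) (T n)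
      (row_major (fun u v => dist_word (D' u v))).

Definition is_minplus (n1 n2 n3 : nat) (A : 'M[nat]_(n1, n2))
    (B : 'M[nat]_(n2, n3)) (C : 'M[nat]_(n1, n3)) : Prop :=
  forall i j, (exists k, C i j = A i k + B k j) /\
              (forall k, C i j <= A i k + B k j).

Definition minplus_input (n1 n2 n3 M : nat) (A : 'M[nat]_(n1, n2))
    (B : 'M[nat]_(n2, n3)) : seq nat :=
  [:: n1; n2; n3; M] ++ row_major A ++ row_major B.

(* [tau] is the running time of one program computing Min-Plus products for    *)
(* all parameters (n1, n2, n3 | M) in the family [F].  A bound "M* <= g on F"  *)
(* for the best running time M* means that some such [tau] is bounded by g;    *)
(* the best running time is an asymptotic notion for a family of parameters,   *)
(* not a number attached to each single quadruple.                             *)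
Definition minplus_in_time (F : nat -> nat -> nat -> nat -> Prop)
    (tau : nat -> nat -> nat -> nat -> nat) : Prop :=
  exists (Q : program) (kappa : nat), forall n1 n2 n3 M, F n1 n2 n3 M ->
  forall (A : 'M[nat]_(n1, n2)) (B : 'M[nat]_(n2, n3)),
    (forall i k, A i k <= M) -> (forall k j, B k j <= M) ->
  exists C : 'M[nat]_(n1, n3),
    is_minplus A B C /\
    computes_within (wordlen kappa (n1 + n2 + n3 + M)) Q
      (minplus_input M A B) (tau n1 n2 n3 M) (row_major C).

(* Integer entries are at most l / f l iff they are at most its floor. *)
Definition entry_bound (R : realType) (f : nat -> R) (l : nat) : nat :=
  Num.truncn (l%:R / f l)%R.

Definition tradeoff_family (R : realType) (f : nat -> R) (n1 n2 n3 M : nat) :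
    Prop :=
  exists n l, [/\ 1 <= l <= n, n1 = n, n2 = n %/ l, n3 = n
                & M = entry_bound f l].

(* Main.v *)
From mathcomp Require Import all_boot all_order all_algebra.
From mathcomp Require Import reals.
From mathcomp Require Import zify.
Require Import Defs.

(** Let [m = n %/ l] and [L = n %/ m >= l].  Each index [k < m] becomes a
    directed path with about [L + s * M / 2] vertices, where [s] is about
    [2 * L / M]; row [i] enters this path at a position that decreases with
    [s * A i k], and column [j] is left from it at a position that increases
    with [s * B k j].  The distance from [i] to [j] is then
    [L + 2 + s * min_k (A i k + B k j)] up to a known shift.  It is at least [l],
    so monotonicity of [l / f l] bounds the error by [D / M], and this is less
    than [s] once the entries are restricted to intervals of length [M %/ 4]:
    the product can be read off.  Splitting the entries into 4 classes each,
    the rows and columns into 8 blocks each, and the indices [k] into constantly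
    many blocks makes every instance fit into exactly [n] vertices, so no
    regularity of [T] is needed.  A constant number of indices [k] is treated by
    brute force, which suffices if [m] is bounded.  Writing the answer takes
    [n * n] steps, hence all the bookkeeping is absorbed by [T n].

    On the machine side, the given program runs on [v]-bit words inside a
    [w]-bit one, [v < w]: results are reduced modulo [2 ^ v], and every
    simulated run gets a fresh block of [2 ^ v] memory words, so that nothing
    ever has to be cleared. *)

Set Implicit Arguments.
Unset Strict Implicit.
Unset Printing Implicit Defensive.

Import Order.TTheory GRing.Theory Num.Theory.

(** * Programs with structured control flow *)

(** Jump targets are absolute, so a fragment is a function of the address where it is placed. *)
Definition code := nat -> seq instr.

Definition code_at (prog : program) (p : nat) (c : seq instr) : Prop :=
  exists pre post, prog = pre ++ c ++ post /\ size pre = p.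

Definition assertion := (nat -> nat) -> (nat -> nat) -> seq nat -> seq nat -> Prop.

(** Total correctness with a time bound, wherever the fragment is placed: control reaches its end
    within [t] steps. *)
Definition wp (w : nat) (c : code) (t : nat) (Q : assertion)
    (g m : nat -> nat) (x y : seq nat) : Prop :=
  forall prog p, code_at prog p (c p) ->
  exists t' g' m' x' y', [/\ t' <= t,
    iter t' (step w prog) (State p g m x y) = State (p + size (c p)) g' m' x' y'
    & Q g' m' x' y'].

Definition skip : code := fun=> [::].
Definition ins (i : instr) : code := fun=> [:: i].
Definition cseq (c1 c2 : code) : code :=
  fun p => c1 p ++ c2 (p + size (c1 p)).
(** The else-branch comes first; [j] jumps over it to the then-branch. *)
Definition ifj (j : nat -> instr) (c1 c2 : code) : code := fun p =>
  let e := c2 p.+1 in let q := p.+2 + size e in let th := c1 q in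
  j q :: e ++ Jmp (q + size th) :: th.
Definition while_lt (a b : nat) (c : code) : code := fun p =>
  let bd := c p.+2 in
  Jlt a b p.+2 :: Jmp (p + 3 + size bd) :: bd ++ [:: Jmp p].
Definition cseqs (cs : seq code) : code := foldr cseq skip cs.
Arguments cseqs : simpl never.

Lemma code_at_catl prog p c1 c2 : code_at prog p (c1 ++ c2) -> code_at prog p c1.
Proof. by move=> [pre [post [-> <-]]]; exists pre, (c2 ++ post); rewrite -!catA. Qed.

Lemma code_at_catr prog p c1 c2 :
  code_at prog p (c1 ++ c2) -> code_at prog (p + size c1) c2.
Proof.
move=> [pre [post [-> <-]]]; exists (pre ++ c1), post.
by rewrite size_cat -!catA.
Qed.

Lemma code_at_cons prog p i c : code_at prog p (i :: c) -> code_at prog p.+1 c.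
Proof. by rewrite -cat1s => /code_at_catr; rewrite addn1. Qed.

Lemma code_at_head prog p i c : code_at prog p (i :: c) -> onth prog p = Some i.
Proof.
move=> [pre [post [-> <-]]].
by rewrite onthE map_cat nth_cat size_map ltnn subnn.
Qed.

Lemma step_at w prog p i c g m x y : code_at prog p (i :: c) ->
  step w prog (State p g m x y) = exec_instr w i (State p g m x y).
Proof. by move=> /code_at_head; rewrite /step /= => ->. Qed.

(** * Proof rules with time bounds *)

Section Rules.
Variables (w : nat).
Implicit Types (Q : assertion) (c : code).

Lemma wp_weaken c t t' Q Q' g m x y :
  wp w c t Q g m x y -> t <= t' ->
  (forall g m x y, Q g m x y -> Q' g m x y) -> wp w c t' Q' g m x y.
Proof.
move=> H le_t QQ' prog p /H[u [g' [m' [x' [y' [lu e q]]]]]].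
exists u, g', m', x', y'; split; [exact: leq_trans lu le_t|by []|exact: QQ'].
Qed.

Lemma wp_skip t Q g m x y : Q g m x y -> wp w skip t Q g m x y.
Proof.
by move=> q prog p _; exists 0, g, m, x, y; split=> //=; rewrite addn0.
Qed.

Lemma wp_seq c1 c2 t1 t2 Q g m x y :
  wp w c1 t1 (wp w c2 t2 Q) g m x y -> wp w (cseq c1 c2) (t1 + t2) Q g m x y.
Proof.
move=> H prog p hc.
have [u1 [g1 [m1 [x1 [y1 [l1 e1 H1]]]]]] := H _ _ (code_at_catl hc).
have [u2 [g2 [m2 [x2 [y2 [l2 e2 q]]]]]] := H1 _ _ (code_at_catr hc).
exists (u2 + u1), g2, m2, x2, y2; split=> //; first lia.
by rewrite iterD e1 e2 size_cat addnA.
Qed.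

Lemma wp_cons c cs t1 t2 Q g m x y :
  wp w c t1 (wp w (cseqs cs) t2 Q) g m x y ->
  wp w (cseqs (c :: cs)) (t1 + t2) Q g m x y.
Proof. exact: wp_seq. Qed.

Lemma wp_cseqs c cs t1 t Q g m x y : t1 <= t ->
  wp w c t1 (wp w (cseqs cs) (t - t1) Q) g m x y ->
  wp w (cseqs (c :: cs)) t Q g m x y.
Proof. by move=> le H; rewrite -(subnKC le); apply: wp_seq. Qed.

Lemma wp_const r v cs t Q g m x y : v < 2 ^ w -> 0 < t ->
  wp w (cseqs cs) t.-1 Q (upd g r v) m x y ->
  wp w (cseqs (ins (Const r v) :: cs)) t Q g m x y.
Proof.
move=> hv ht H; apply: (@wp_cseqs _ _ 1) => //; rewrite subn1 => prog p hc.
by exists 1, (upd g r v), m, x, y; rewrite /= (step_at w _ _ _ _ hc) /= modn_small // addn1.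
Qed.

Lemma wp_op o r a b v cs t Q g m x y : eval_binop w o (g a) (g b) = v -> 0 < t ->
  wp w (cseqs cs) t.-1 Q (upd g r v) m x y ->
  wp w (cseqs (ins (Op o r a b) :: cs)) t Q g m x y.
Proof.
move=> <- ht H; apply: (@wp_cseqs _ _ 1) => //; rewrite subn1 => prog p hc.
by exists 1; do 4 eexists; rewrite /= (step_at w _ _ _ _ hc) /= addn1; split=> //.
Qed.

Lemma wp_get r a v cs t Q g m x y : m (g a) = v -> 0 < t ->
  wp w (cseqs cs) t.-1 Q (upd g r v) m x y ->
  wp w (cseqs (ins (MemGet r a) :: cs)) t Q g m x y.
Proof.
move=> <- ht H; apply: (@wp_cseqs _ _ 1) => //; rewrite subn1 => prog p hc.
by exists 1; do 4 eexists; rewrite /= (step_at w _ _ _ _ hc) /= addn1; split=> //.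
Qed.

Lemma wp_set a r va vr cs t Q g m x y : g a = va -> g r = vr -> 0 < t ->
  wp w (cseqs cs) t.-1 Q g (upd m va vr) x y ->
  wp w (cseqs (ins (MemSet a r) :: cs)) t Q g m x y.
Proof.
move=> <- <- ht H; apply: (@wp_cseqs _ _ 1) => //; rewrite subn1 => prog p hc.
by exists 1; do 4 eexists; rewrite /= (step_at w _ _ _ _ hc) /= addn1; split=> //.
Qed.

Lemma wp_read r v x' cs t Q g m x y : x = v :: x' -> v < 2 ^ w -> 0 < t ->
  wp w (cseqs cs) t.-1 Q (upd g r v) m x' y ->
  wp w (cseqs (ins (Read r) :: cs)) t Q g m x y.
Proof.
move=> -> hv ht H; apply: (@wp_cseqs _ _ 1) => //; rewrite subn1 => prog p hc.
by exists 1; do 4 eexists; rewrite /= (step_at w _ _ _ _ hc) /= addn1 modn_small //; split=> //.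
Qed.

Lemma wp_write r cs t Q g m x y : 0 < t ->
  wp w (cseqs cs) t.-1 Q g m x (rcons y (g r)) ->
  wp w (cseqs (ins (Write r) :: cs)) t Q g m x y.
Proof.
move=> ht H; apply: (@wp_cseqs _ _ 1) => //; rewrite subn1 => prog p hc.
by exists 1; do 4 eexists; rewrite /= (step_at w _ _ _ _ hc) /= addn1; split=> //.
Qed.

Lemma wp_ifj (b : bool) j c1 c2 t Q g m x y :
  (forall l p, exec_instr w (j l) (State p g m x y) =
     State (if b then l else p.+1) g m x y) ->
  (b -> wp w c1 t Q g m x y) -> (~~ b -> wp w c2 t Q g m x y) ->
  wp w (ifj j c1 c2) t.+2 Q g m x y.
Proof.
rewrite /wp /ifj => hj H1 H2 prog p; set e := c2 _; set q := p.+2 + _ => hc.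
have hs := step_at w g m x y hc; rewrite {}hj in hs.
have he := code_at_catl (code_at_cons hc).
have hJ := code_at_catr (code_at_cons hc).
have ht : code_at prog q (c1 q) by have := code_at_cons hJ; rewrite -addSn.
case: b hs H1 H2 => hs H1 H2.
- have [u [g' [m' [x' [y' [l1 e1 q1]]]]]] := H1 isT _ _ ht.
  exists u.+1, g', m', x', y'; rewrite iterSr hs e1; split=> //; first lia.
  by rewrite /= size_cat /=; congr State; lia.
- have [u [g' [m' [x' [y' [l1 e1 q1]]]]]] := H2 isT _ _ he.
  exists (u.+2), g', m', x', y'; rewrite iterS iterSr hs e1; split=> //.
  rewrite (step_at w _ _ _ _ hJ) /= size_cat /=.
  by congr State; lia.
Qed.

Lemma wp_if_lt a b c1 c2 cs t t1 Q g m x y : t1.+2 <= t ->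
  (g a < g b -> wp w c1 t1 (wp w (cseqs cs) (t - t1.+2) Q) g m x y) ->
  (g b <= g a -> wp w c2 t1 (wp w (cseqs cs) (t - t1.+2) Q) g m x y) ->
  wp w (cseqs (ifj (Jlt a b) c1 c2 :: cs)) t Q g m x y.
Proof.
move=> ht H1 H2; apply: (wp_cseqs ht); apply: (@wp_ifj (g a < g b)) => //.
by rewrite -leqNgt.
Qed.

Lemma wp_if_eq a b c1 c2 cs t t1 Q g m x y : t1.+2 <= t ->
  (g a = g b -> wp w c1 t1 (wp w (cseqs cs) (t - t1.+2) Q) g m x y) ->
  (g a <> g b -> wp w c2 t1 (wp w (cseqs cs) (t - t1.+2) Q) g m x y) ->
  wp w (cseqs (ifj (Jeq a b) c1 c2 :: cs)) t Q g m x y.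
Proof.
move=> ht H1 H2; apply: (wp_cseqs ht).
by apply: (@wp_ifj (g a == g b)) => // /eqP.
Qed.

(** The invariant is indexed by the finished rounds, and [N] is their exact number. Each round pays
    2 for the test and the jump back, and the last 2 steps are the failing test and the exit
    jump. *)
Lemma wp_while a b c N tb (Inv : nat -> assertion) Q g m x y :
  Inv 0 g m x y ->
  (forall k g m x y, k < N -> Inv k g m x y ->
     g a < g b /\ wp w c tb (Inv k.+1) g m x y) ->
  (forall g m x y, Inv N g m x y -> g b <= g a /\ Q g m x y) ->
  wp w (while_lt a b c) (N * tb.+2 + 2) Q g m x y.
Proof.
move=> I0 IS IN prog p; rewrite /while_lt; set bd := c p.+2 => hc.
have hs g1 m1 x1 y1 := step_at w g1 m1 x1 y1 hc.
have hJ := code_at_cons hc; have hB := code_at_catl (code_at_cons hJ).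
have hE := code_at_catr (code_at_cons hJ).
have {}hs k g1 m1 x1 y1 : k <= N -> Inv k g1 m1 x1 y1 ->
  exists t' g' m' x' y', [/\ t' <= (N - k) * tb.+2 + 2,
    iter t' (step w prog) (State p g1 m1 x1 y1) =
      State (p + 3 + size bd) g' m' x' y' & Q g' m' x' y'].
  (* Induction on the number [N - k] of rounds still to come. *)
  move=> lek; rewrite -{1}(subKn lek); move: (N - k) (leq_subr k N) => d.
  elim: d g1 m1 x1 y1 => [|d IH] g1 m1 x1 y1 ld I1.
    move: I1; rewrite subn0 => /IN[h1 h2].
    exists 2, g1, m1, x1, y1; split=> //.
    by rewrite /= hs /= ltnNge h1 /= (step_at w _ _ _ _ hJ).
  have h : N - d.+1 < N by lia.
  have [h1 h2] := IS _ _ _ _ _ h I1.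
  have [u [g' [m' [x' [y' [l1 e1 q1]]]]]] := h2 _ _ hB.
  have ed : (N - d.+1).+1 = N - d by lia.
  rewrite ed in q1.
  have [|u2 [g2 [m2 [x2 [y2 [l2 e2 q2]]]]]] := IH _ _ _ _ _ q1; first lia.
  exists (u2 + u.+2), g2, m2, x2, y2; split=> //; first by nia.
  by rewrite iterD iterS iterSr hs /= h1 e1 (step_at w _ _ _ _ hE) /= e2.
have [u [g' [m' [x' [y' [l1 e1 q1]]]]]] := hs 0 _ _ _ _ (leq0n _) I0.
exists u, g', m', x', y'; rewrite subn0 in l1; split=> //.
by rewrite e1 /= size_cat /=; congr State; lia.
Qed.

End Rules.

(** * Word arithmetic without overflow *)

Section Arith.
Variable w : nat.

Lemma eval_add x y : x + y < 2 ^ w -> eval_binop w Add x y = x + y.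
Proof. exact: modn_small. Qed.
Lemma eval_mul x y : x * y < 2 ^ w -> eval_binop w Mul x y = x * y.
Proof. exact: modn_small. Qed.
Lemma eval_sub x y : y <= x < 2 ^ w -> eval_binop w Sub x y = x - y.
Proof.
move=> /andP[le lt]; rewrite /eval_binop.
have -> : x + (2 ^ w - y) = x - y + 2 ^ w by lia.
by rewrite modnDr modn_small //; lia.
Qed.
Lemma eval_div x y : x < 2 ^ w -> eval_binop w Div x y = x %/ y.
Proof. by move=> h; apply: modn_small; apply: leq_ltn_trans h; apply: leq_div. Qed.
Lemma eval_mod x y : x < 2 ^ w -> eval_binop w Mod x y = x %% y.
Proof. by move=> h; apply: modn_small; apply: leq_ltn_trans h; apply: leq_mod. Qed.
End Arith.

(** * Simulation of a program with shorter words *)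

(** The shift keeps the registers of the simulated program apart from those of the surrounding
    one. *)
Definition preg (r : nat) : nat := 64 + r.

(* Register 4 holds 1, 8 the end of the input in memory, 10 the modulus, 29 the base of
   the simulated memory, 40 and 41 the input and output pointers.  The input pointer
   stops at the end: a run may read more often than addresses can count. *)
Definition sim_body (tgt : nat -> nat) (q : nat) (i : instr) : seq instr :=
  match i with
  | Const r c => [:: Const (preg r) c; Op Mod (preg r) (preg r) 10]
  | Op o r a b => [:: Op o (preg r) (preg a) (preg b); Op Mod (preg r) (preg r) 10]
  | MemGet r a => [:: Op Add 42 29 (preg a); MemGet (preg r) 42]
  | MemSet a r => [:: Op Add 42 29 (preg a); MemSet 42 (preg r)]
  | Read r => [:: Const (preg r) 0; Jlt 40 8 (q + 3); Jmp (q + 6);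
                  MemGet (preg r) 40; Op Add 40 40 4; Op Mod (preg r) (preg r) 10]
  | Write r => [:: MemSet 41 (preg r); Op Add 41 41 4]
  | Jmp l => [:: Jmp (tgt l)]
  | Jeq a b l => [:: Jeq (preg a) (preg b) (tgt l)]
  | Jlt a b l => [:: Jlt (preg a) (preg b) (tgt l)]
  end.

(* Every instruction becomes a block of length 6, so that jump targets scale. *)
Definition sim_block (tgt : nat -> nat) (q : nat) (i : instr) : seq instr :=
  let b := sim_body tgt q i in b ++ nseq (6 - size b) (Jmp (q + 6)).

Fixpoint sim_from (tgt : nat -> nat) (q : nat) (P : program) : seq instr :=
  if P is i :: P' then sim_block tgt q i ++ sim_from tgt (q + 6) P' else [::].

(** A jump out of the program text halts, so all such targets are sent to the end of the translated
    code. *)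
Definition sim_tgt (P : program) (base l : nat) := base + 6 * minn l (size P).

Definition sim (P : program) : code := fun base => sim_from (sim_tgt P base) base P.

Definition instr_regs (i : instr) : seq nat :=
  match i with
  | Const r _ => [:: r]
  | Op _ r a b => [:: r; a; b]
  | MemGet r a => [:: r; a]
  | MemSet a r => [:: a; r]
  | Read r => [:: r]
  | Write r => [:: r]
  | Jmp _ => [::]
  | Jeq a b _ => [:: a; b]
  | Jlt a b _ => [:: a; b]
  end.

Definition prog_regs (P : program) : seq nat := flatten (map instr_regs P).

(** Only registers occurring in the text of [P] matter, so a number of assignments depending on [P]
    alone restores the initial registers. *)
Definition reset (P : program) : seq code :=
  [seq ins (Const (preg r) 0) | r <- prog_regs P].

Lemma size_sim_block tgt q i : size (sim_block tgt q i) = 6.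
Proof. by case: i. Qed.

Lemma size_sim_from tgt q P : size (sim_from tgt q P) = 6 * size P.
Proof.
by elim: P q => //= i P IH q; rewrite size_cat IH size_sim_block mulnS.
Qed.

Lemma code_at_sim_from prog tgt q P k i :
  code_at prog q (sim_from tgt q P) -> onth P k = Some i ->
  code_at prog (q + 6 * k) (sim_block tgt (q + 6 * k) i).
Proof.
elim: P q k => [|j P IH] q [|k] //= hc.
  by case=> <-; rewrite muln0 addn0; apply: code_at_catl hc.
move=> hk; have := code_at_catr hc; rewrite size_sim_block => /IH/(_ hk).
by have -> : q + 6 + 6 * k = q + 6 * k.+1 by lia.
Qed.


Lemma prog_regs_sub P k i : onth P k = Some i -> {subset instr_regs i <= prog_regs P}.
Proof.
rewrite /prog_regs; elim: P k => [|j P IH] [|k] //=.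
  by case=> -> r hr; rewrite mem_cat hr.
by move=> /IH h r /h; rewrite mem_cat => ->; rewrite orbT.
Qed.

(** Apart from the final reduction, only [Sub] mentions the word length, and for [y < 2 ^ v] this
    changes the result by a multiple of [2 ^ v]. *)
Lemma eval_binop_narrow w v o x y : v <= w -> y < 2 ^ v ->
  eval_binop w o x y %% 2 ^ v = eval_binop v o x y.
Proof.
move=> vw hy; rewrite /eval_binop modn_dvdm; last exact: dvdn_exp2l.
case: o => //.
have [d ->] : exists d, w = d + v by exists (w - v); lia.
have h1 : 0 < 2 ^ d by rewrite expn_gt0.
have -> : x + (2 ^ (d + v) - y) = (2 ^ d).-1 * 2 ^ v + (x + (2 ^ v - y)).
  by rewrite expnD; nia.
by rewrite modnMDl.
Qed.

Lemma eval_binop_lt v o x y : eval_binop v o x y < 2 ^ v.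
Proof. by rewrite ltn_mod expn_gt0. Qed.

(** * Correctness of the simulation *)

Section Sim.
Variables (P : program) (v w : nat) (vw : v < w).
Variables (g0 m0 : nat -> nat) (gin : seq nat) (ib ob pb lim : nat).
Hypothesis (one0 : g0 4 = 1) (end0 : g0 8 = ob) (mask0 : g0 10 = 2 ^ v) (pb0 : g0 29 = pb).
Hypothesis (gin_end : ib + size gin = ob) (ob_pb : ob + lim <= pb) (pb_lt : pb + 2 ^ v < 2 ^ w).
Hypothesis (gin0 : forall i, i < size gin -> m0 (ib + i) = nth 0 gin i).

(** The simulated input lies between [ib] and [ob], the output from [ob] on, the simulated memory
    from [pb] on. The last two clauses record what the simulation leaves untouched. *)
Definition simrel (s : state) (g m : nat -> nat) : Prop :=
  [/\ forall r, r \in prog_regs P -> g (preg r) = reg s r,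
      (forall r, reg s r < 2 ^ v) /\ (forall a, mem s a < 2 ^ v),
      forall a, a < 2 ^ v -> m (pb + a) = mem s a,
      exists c, [/\ c <= size gin, g 40 = ib + c & inp s = drop c gin] &
      [/\ g 41 = ob + size (out s),
          forall i, i < size (out s) -> m (ob + i) = nth 0 (out s) i,
          forall r, r < 40 -> g r = g0 r &
          forall a, a < ob \/ pb + 2 ^ v <= a -> m a = m0 a]].

Lemma simrel_ext s g g' m : g =1 g' -> simrel s g m -> simrel s g' m.
Proof.
move=> e [h1 h2 h4 [c [c1 c2 c3]] [h5 h6 h7 h8]]; split=> //.
- by move=> r /h1; rewrite e.
- by exists c; rewrite -e.
- by split=> // [|r]; rewrite -e; auto.
Qed.

Lemma simrel_tmp s g m z : simrel s g m -> simrel s (upd g 42 z) m.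
Proof.
move=> [h1 h2 h4 [c [c1 c2 c3]] [h5 h6 h7 h8]]; split=> //.
- by exists c.
- by split=> // r hr; rewrite /upd ifN ?h7 //; lia.
Qed.

Lemma simrel_pc p p' g m x y G M :
  simrel (State p g m x y) G M -> simrel (State p' g m x y) G M.
Proof. by []. Qed.

Lemma simrel_reg p p' g m x y G M r z : z < 2 ^ v ->
  simrel (State p g m x y) G M ->
  simrel (State p' (upd g r z) m x y) (upd G (preg r) z) M.
Proof.
move=> hz [h1 [h2 h3] h4 [c [c1 c2 c3]] [h5 h6 h7 h8]]; split=> //=.
- by move=> r' hr'; rewrite /upd eqn_add2l h1.
- by split=> // r'; rewrite /upd; case: eqP.
- by exists c.
- by split=> // r' hr'; rewrite /upd /preg ifN ?h7 //; lia.
Qed.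

(** Jumps inside a block only lead forward, so its 6 instructions take at most 6 steps; a halted
    state takes none. The bound [lim] keeps the output below [pb]. *)
Lemma sim_step prog base s g m x y : code_at prog base (sim P base) ->
  size (out (step v P s)) <= lim -> simrel s g m ->
  exists t g' m', [/\ t <= 6,
   iter t (step w prog) (State (sim_tgt P base (pc s)) g m x y) =
   State (sim_tgt P base (pc (step v P s))) g' m' x y &
   simrel (step v P s) g' m'].
Proof.
move=> hc; have -> : step v P s = if onth P (pc s) is Some i then exec_instr v i s else s by [].
case hi : (onth P (pc s)) => [i|]; last first.
  by move=> _ H; exists 0, g, m; split.
have hk : pc s < size P by rewrite -onthTE hi.
have := code_at_sim_from hc hi; have hr := prog_regs_sub hi.
have etgt : sim_tgt P base (pc s) = base + 6 * pc s by rewrite /sim_tgt; lia.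
rewrite -etgt.
have tgtS : sim_tgt P base (pc s).+1 = sim_tgt P base (pc s) + 6.
  by rewrite /sim_tgt; lia.
move: hr tgtS => {hi hk hc etgt}.
case: s => p gP mP xP yP /=; set q := sim_tgt P base p.
move=> hr tgtS hb hlim H; have [h1 [h2 h3] h4 [c [c1 c2 c3]] [h5 h6 h7 h8]] := H.
have w0 : 0 < 2 ^ v by rewrite expn_gt0.
have v2w : 2 ^ v < 2 ^ w by rewrite ltn_exp2l.
have hone : g 4 = 1 by rewrite h7.
have hend : g 8 = ob by rewrite h7.
have hmask : g 10 = 2 ^ v by rewrite h7.
have hpb : g 29 = pb by rewrite h7.
have pr a b : (preg a == preg b) = (a == b) by rewrite eqn_add2l.
have pn a b : b < 64 -> (b == preg a) = false by rewrite /preg; lia.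
have wv z : z %% 2 ^ w %% 2 ^ v = z %% 2 ^ v.
  by rewrite modn_dvdm // dvdn_exp2l // ltnW.
have ww z : z < 2 ^ v -> z %% 2 ^ w = z by move=> hz; rewrite modn_small //; lia.
have nz z : z %% 2 ^ v < 2 ^ v by rewrite ltn_mod.
case: i hr hb hlim => /=.
- move=> r cst hr hb _; have hb1 := code_at_cons hb; have hb2 := code_at_cons hb1.
  exists 3; do 2 eexists; split=> //.
    rewrite /= (step_at w _ _ _ _ hb) /= (step_at w _ _ _ _ hb1) /=.
    by rewrite (step_at w _ _ _ _ hb2) /= tgtS.
  apply: simrel_ext (simrel_reg p.+1 r (nz cst) H).
  move=> z; rewrite /upd eqxx (pn r 10) // hmask /eval_binop; case: eqP => // _.
  by rewrite wv ww.
- move=> o r a b hr hb _; have hb1 := code_at_cons hb; have hb2 := code_at_cons hb1.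
  exists 3; do 2 eexists; split=> //.
    rewrite /= (step_at w _ _ _ _ hb) /= (step_at w _ _ _ _ hb1) /=.
    by rewrite (step_at w _ _ _ _ hb2) /= tgtS.
  apply: simrel_ext (simrel_reg p.+1 r (eval_binop_lt v o (gP a) (gP b)) H).
  move=> z; rewrite /upd eqxx (pn r 10) // hmask; case: eqP => // _.
  have ha : a \in prog_regs P by apply: hr; rewrite !inE eqxx ?orbT.
  have hb' : b \in prog_regs P by apply: hr; rewrite !inE eqxx ?orbT.
  by rewrite (h1 _ ha) (h1 _ hb') eval_mod ?eval_binop_lt // eval_binop_narrow ?h2 // ltnW.
- move=> r a hr hb _; have hb1 := code_at_cons hb; have hb2 := code_at_cons hb1.
  exists 3; do 2 eexists; split=> //.
    rewrite /= (step_at w _ _ _ _ hb) /= (step_at w _ _ _ _ hb1) /=.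
    by rewrite (step_at w _ _ _ _ hb2) /= tgtS.
  have ha : a \in prog_regs P by apply: hr; rewrite !inE eqxx ?orbT.
  apply: simrel_ext (simrel_reg p.+1 r (h3 (gP a)) (simrel_tmp (pb + gP a) H)).
  move=> z; have hga := h2 a; rewrite /= in hga.
  by rewrite {2}/upd; rewrite hpb (h1 _ ha) /= eval_add; [rewrite /upd /= h4|lia].
- move=> a r hr hb hlim; have hb1 := code_at_cons hb; have hb2 := code_at_cons hb1.
  exists 3; do 2 eexists; split=> //.
    rewrite /= (step_at w _ _ _ _ hb) /= (step_at w _ _ _ _ hb1) /=.
    by rewrite (step_at w _ _ _ _ hb2) /= tgtS.
  have ha : a \in prog_regs P by apply: hr; rewrite !inE eqxx ?orbT.
  have hr' : r \in prog_regs P by apply: hr; rewrite !inE eqxx ?orbT.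
  have hga := h2 a; rewrite /= in hga.
  have e2 : upd g 42 (eval_binop w Add (g 29) (g (preg a))) (preg r) = gP r.
    by rewrite /upd eq_sym pn // h1.
  have e1 : upd g 42 (eval_binop w Add (g 29) (g (preg a))) 42 = pb + gP a.
    by rewrite {1}/upd /= hpb (h1 _ ha) /= eval_add //; lia.
  rewrite e1 e2.
  have [k1 k2 k4 k5 [k6 k7 k8 k9]] := simrel_tmp (eval_binop w Add (g 29) (g (preg a))) H.
  split=> //=.
  + by split=> // z; rewrite /upd; case: eqP.
  + by move=> z hz; rewrite /upd eqn_add2l h4.
  + split=> //.
      by move=> z hz; rewrite /upd ifN ?h6 //; rewrite /= in hz h5; lia.
    by move=> z hz; rewrite /upd ifN ?h8 //; lia.
- move=> r hr hb _; have hb1 := code_at_cons hb; have hb2 := code_at_cons hb1.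
  have hb3 := code_at_cons hb2; have hb4 := code_at_cons hb3; have hb5 := code_at_cons hb4.
  have hb' z : upd g (preg r) z 40 = ib + c by rewrite /upd pn.
  have hb'' z : upd g (preg r) z 8 = ob by rewrite /upd pn.
  (* Reading past the end of the input yields 0, the default of [head], and the pointer stays. *)
  have [lc|gc] := ltnP c (size gin); last first.
    have cE : c = size gin by lia.
    exists 3; do 2 eexists; split=> //.
      rewrite /= (step_at w _ _ _ _ hb) /= (step_at w _ _ _ _ hb1) /= hb' hb'' ltnNge.
      rewrite (_ : ob <= ib + c) /=; last lia.
      by rewrite (step_at w _ _ _ _ hb2) /= tgtS.
    rewrite /= cE drop_size in c3; rewrite c3 /= !mod0n.
    by apply: (simrel_reg (p := p) p.+1 r w0); rewrite -c3.
  exists 5; do 2 eexists; split=> //.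
    rewrite /= (step_at w _ _ _ _ hb) /= (step_at w _ _ _ _ hb1) /= hb' hb''.
    rewrite (_ : ib + c < ob) /=; last lia.
    have -> : q + 3 = q.+3 by lia.
    rewrite (step_at w _ _ _ _ hb3) /= (step_at w _ _ _ _ hb4) /=.
    rewrite (step_at w _ _ _ _ hb5) /= tgtS.
    by have -> : q.+4.+2 = q + 6 by lia.
  rewrite /= in c3; rewrite c3 (drop_nth 0 lc) /=.
  set G := (X in simrel _ X _).
  suff [e1 e2 e3] : [/\ G 40 = ib + c.+1, G (preg r) = nth 0 gin c %% 2 ^ v &
    forall z, z != 40 -> z != preg r -> G z = g z].
    split=> //=.
    + move=> r' hr'; rewrite /upd; have [->//|ne] := eqVneq r' r.
      by rewrite e3 ?h1 ?pr.
    + by split=> // r'; rewrite /upd; case: eqP.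
    + by exists c.+1.
    + split=> //.
      by move=> z hz; rewrite e3 ?h7 //; rewrite /preg; lia.
  rewrite /G {G} hb'; have hm : m (ib + c) = nth 0 gin c by rewrite h8 ?gin0 //; lia.
  rewrite hm /upd (pn r 10) // (pn r 40) // (pn r 4) //
    !eqxx (eq_sym (preg r) 40) (pn r 40) // hmask c2 hone /=.
  split.
  + by rewrite eval_add; lia.
  + by rewrite /eval_binop ww.
  + by move=> z /negbTE -> /negbTE ->.
- move=> r hr hb hlim; have hb1 := code_at_cons hb; have hb2 := code_at_cons hb1.
  exists 3; do 2 eexists; split=> //.
    rewrite /= (step_at w _ _ _ _ hb) /= (step_at w _ _ _ _ hb1) /=.
    by rewrite (step_at w _ _ _ _ hb2) /= tgtS.
  have hr' : r \in prog_regs P by apply: hr; rewrite !inE eqxx ?orbT.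
  rewrite /= in h5; rewrite size_rcons in hlim.
  rewrite h5 hone eval_add; last lia.
  split=> //=.
  + by move=> z hz; rewrite /upd ifN ?h4 //; lia.
  + by exists c.
  + rewrite size_rcons; split.
    * by rewrite /upd /=; lia.
    * move=> z hz; rewrite nth_rcons /upd eqn_add2l h1 //.
      have [->|ne] := eqVneq z (size yP); first by rewrite ltnn.
      by rewrite ifT ?h6 //=; lia.
    * by move=> z hz; rewrite /upd ifN ?h7 //; lia.
    * by move=> z hz; rewrite /upd ifN ?h8 //; lia.
- move=> l hr hb _; exists 1; do 2 eexists; split=> //.
    by rewrite /= (step_at w _ _ _ _ hb) /=.
  exact: (simrel_pc l H).
- move=> a b l hr hb _; have hb1 := code_at_cons hb.
  have ha : a \in prog_regs P by apply: hr; rewrite !inE eqxx ?orbT.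
  have hb' : b \in prog_regs P by apply: hr; rewrite !inE eqxx ?orbT.
  have := step_at w g m x y hb; rewrite /= (h1 _ ha) (h1 _ hb') /=.
  case: eqP => _ hs.
    by exists 1; do 2 eexists; split=> //; [rewrite /= hs|exact: (simrel_pc l H)].
  exists 2; do 2 eexists; split=> //; last exact: (simrel_pc p.+1 H).
  by rewrite /= hs (step_at w _ _ _ _ hb1) /= tgtS.
- move=> a b l hr hb _; have hb1 := code_at_cons hb.
  have ha : a \in prog_regs P by apply: hr; rewrite !inE eqxx ?orbT.
  have hb' : b \in prog_regs P by apply: hr; rewrite !inE eqxx ?orbT.
  have := step_at w g m x y hb; rewrite /= (h1 _ ha) (h1 _ hb') /=.
  case: ltnP => _ hs.
    by exists 1; do 2 eexists; split=> //; [rewrite /= hs|exact: (simrel_pc l H)].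
  exists 2; do 2 eexists; split=> //; last exact: (simrel_pc p.+1 H).
  by rewrite /= hs (step_at w _ _ _ _ hb1) /= tgtS.
Qed.

Lemma size_out_step s : size (out s) <= size (out (step v P s)).
Proof.
rewrite /step; case: onth => // i; case: s => p g m x y.
by case: i => //= r; rewrite size_rcons.
Qed.

Lemma sim_run prog base s g m x y t : code_at prog base (sim P base) ->
  size (out (iter t (step v P) s)) <= lim -> simrel s g m ->
  exists t' g' m', [/\ t' <= t * 6,
   iter t' (step w prog) (State (sim_tgt P base (pc s)) g m x y) =
   State (sim_tgt P base (pc (iter t (step v P) s))) g' m' x y &
   simrel (iter t (step v P) s) g' m'].
Proof.
move=> hc; elim: t => [|t IH] /= hlim H; first by exists 0, g, m.
have [|t1 [g1 [m1 [l1 e1 H1]]]] := IH _ H.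
  exact: leq_trans (size_out_step _) hlim.
have [t2 [g2 [m2 [l2 e2 H2]]]] := sim_step x y hc hlim H1.
exists (t2 + t1), g2, m2; split=> //; first by lia.
by rewrite iterD e1.
Qed.

(** A halted program counter is at least [size P], which [sim_tgt] maps to the end of the translated
    code. *)
Lemma wp_sim Q g x y xs ys t :
  simrel (init xs) g m0 -> computes_within v P xs t ys -> size ys <= lim ->
  (forall g' m', (forall r, r < 40 -> g' r = g0 r) ->
     (forall a, a < ob \/ pb + 2 ^ v <= a -> m' a = m0 a) ->
     (forall i, i < size ys -> m' (ob + i) = nth 0 ys i) -> Q g' m' x y) ->
  wp w (sim P) (t * 6) Q g m0 x y.
Proof.
move=> H [hpc hout] hlim HQ prog p hc; rewrite -hout in hlim HQ.
have [t' [g' [m' [lt et [_ _ _ _ [_ h6 h7 h8]]]]]] := sim_run x y hc hlim H.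
exists t', g', m', x, y; split=> //; last exact: HQ.
have e0 : sim_tgt P p (pc (init xs)) = p by rewrite /sim_tgt min0n muln0 addn0.
rewrite e0 in et; rewrite et /sim_tgt; congr State.
by rewrite (minn_idPr hpc) size_sim_from.
Qed.

End Sim.

(** One step writes at most one word; this later yields [n * n <= T n]. *)
Lemma size_out_iter v P xs t : size (out (iter t (step v P) (init xs))) <= t.
Proof.
elim: t => //= t; rewrite -ltnS; apply: leq_trans.
move: (iter _ _ _) => s; rewrite /step; case: onth => // i.
by case: s => p g m x y; case: i => *; rewrite /= ?size_rcons.
Qed.

Lemma wp_reset_regs w rs cs t Q g m x y : size rs <= t ->
  (forall g', (forall r, r < 64 -> g' r = g r) ->
     (forall r, g' (preg r) = if r \in rs then 0 else g (preg r)) ->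
     wp w (cseqs cs) (t - size rs) Q g' m x y) ->
  wp w (cseqs ([seq ins (Const (preg r) 0) | r <- rs] ++ cs)) t Q g m x y.
Proof.
elim: rs t g => [|r rs IH] t g /= ht H.
  by rewrite -[t]subn0; apply: H.
have wgt : 0 < 2 ^ w by rewrite expn_gt0.
apply: wp_const => //; first lia.
apply: IH; first by case: (t) ht.
move=> g' h1 h2; have -> : t.-1 - size rs = t - (size rs).+1 by lia.
apply: H => [r' hr'|r'].
  by rewrite h1 // /upd ifN // /preg; lia.
by rewrite h2 inE orbC; case: (r' \in rs) => //=; rewrite /upd eqn_add2l.
Qed.

(** * The gadget graph *)

Lemma modnS_lt x d : (x %% d).+1 < d -> x.+1 %% d = (x %% d).+1.
Proof. by move=> h; rewrite -addn1 -modnDml addn1 modn_small. Qed.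

Section Gadget.
Variables (n m ib L s sw H i0 j0 k0 tA tB : nat) (a b : nat -> nat -> nat).
Hypothesis (m_gt0 : 0 < m) (H_def : H = L + sw + sw + 1).

(** Vertex [ib + ib + q] lies on path number [q %/ H]. Reduction modulo [m] assigns a genuine inner
    index to every path, even to surplus or truncated ones, which are therefore harmless. *)
Definition mid (q : nat) : nat := (k0 + q %/ H) %% m.

(** The entry position is [sw + tA - s * a], written without subtraction. It exists only if
    [tA <= s * a <= sw + tA], so entries outside the current class get no edge; [leaves] is
    analogous. *)
Definition enters (u q : nat) : bool :=
  (q %% H <= sw) && (q %% H + s * a ((i0 + u) %% n) (mid q) == sw + tA).

Definition leaves (q v : nat) : bool :=
  (sw + L <= q %% H) && (q %% H + tB == sw + L + s * b (mid q) ((j0 + v) %% n)).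

(** Vertices below [ib] are rows, the next [ib] are columns, the rest form the paths. Rows have no
    incoming and columns no outgoing edges, so a walk from a row to a column uses a single path. *)
Definition gadget (u v : nat) : bool :=
  if u < ib then if v < ib + ib then false else enters u (v - (ib + ib))
  else if u < ib + ib then false
  else if v == u.+1 then ((u - (ib + ib)) %% H).+1 < H
  else if v < ib + ib then
    if v < ib then false else leaves (u - (ib + ib)) (v - ib)
  else false.

(** From a path vertex one can only advance by one position or leave to a column, so the two
    positions determine the length; the last edge is the one that leaves. *)
Lemma path_to_sink y p : ib + ib <= y -> path gadget y p ->
  ib <= last y p < ib + ib ->
  [/\ 0 < size p, sw + L <= (y - (ib + ib)) %% H + (size p).-1 &
   (y - (ib + ib)) %% H + (size p).-1 + tB =
   sw + L + s * b (mid (y - (ib + ib))) ((j0 + (last y p - ib)) %% n)].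
Proof.
elim: p y => [|z p IH] y /= hy; first lia.
rewrite {1}/gadget ifN; last lia. rewrite ifN; last lia.
case/andP; case: eqP => [->|_].
  move=> hx hp hl; have [|k1 k2 k3] := IH _ _ hp hl; first lia.
  have e : y.+1 - (ib + ib) = (y - (ib + ib)).+1 by lia.
  have eH := modnS_lt hx.
  have em : mid (y - (ib + ib)).+1 = mid (y - (ib + ib)).
    by rewrite /mid divnS ?H_def; last lia; rewrite -H_def /dvdn eH.
  rewrite e eH in k2 k3; rewrite em in k3; split=> //; lia.
case: ltnP => // h1; case: ltnP => // h2 /andP[k1 /eqP k2].
case: p IH => [|z' p] IH; last first.
  move=> /= /andP[]; rewrite {1}/gadget ifN; last lia.
  by rewrite ifT.
by move=> _ /= _; rewrite addn0; split.
Qed.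

(** The walk enters at a position at most [sw] and leaves at one at least [sw + L]; the two outer
    edges make this [L + 2]. *)
Lemma path_from_source u p : u < ib -> path gadget u p ->
  ib <= last u p < ib + ib ->
  exists kk, [/\ kk < m, L + 2 <= size p &
    size p + tA + tB = L + 2 +
      s * (a ((i0 + u) %% n) kk + b kk ((j0 + (last u p - ib)) %% n))].
Proof.
case: p => [|y p] /= hu; first lia.
rewrite {1}/gadget hu; case: ltnP => // hy /andP[/andP[h1 /eqP h2] hp] hl.
have [k1 k2 k3] := path_to_sink hy hp hl.
exists (mid (y - (ib + ib))); split; last by lia.
  by rewrite ltn_mod.
lia.
Qed.

Lemma path_run y d : ib + ib <= y -> (y - (ib + ib)) %% H + d < H ->
  path gadget y (iota y.+1 d).
Proof.
elim: d y => //= d IH y hy hd; apply/andP; split.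
  rewrite /gadget ifN; last lia; rewrite ifN; last lia; rewrite eqxx; lia.
apply: IH; first lia.
have e : y.+1 - (ib + ib) = (y - (ib + ib)).+1 by lia.
by rewrite e modnS_lt; lia.
Qed.

Lemma gadget_path u v k la lb : u < ib -> ib <= v < ib + ib ->
  ib + ib + k.+1 * H <= n -> s * la <= sw -> s * lb <= sw ->
  s * a ((i0 + u) %% n) ((k0 + k) %% m) = s * la + tA ->
  s * b ((k0 + k) %% m) ((j0 + (v - ib)) %% n) = s * lb + tB ->
  exists p, [/\ path gadget u p, last u p = v, size p = L + 2 + s * (la + lb) &
    all (fun z => z < n) p].
Proof.
move=> hu hv hk ha hb ea eb.
(* [x] is the first vertex of path [k], [x1] the position of entry, [d] the number of edges followed
   along the path. *)
pose x := ib + ib + k * H; pose x1 := sw - s * la; pose d := L + s * (la + lb).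
have dE : x1 + d = sw + L + s * lb by rewrite /x1 /d mulnDr; lia.
have hq z : z < H -> (x + z - (ib + ib)) %% H = z /\ mid (x + z - (ib + ib)) = (k0 + k) %% m.
  move=> hz; have -> : x + z - (ib + ib) = k * H + z by rewrite /x; lia.
  have H0 : 0 < H by lia.
  by rewrite /mid modnMDl divnMDl // divn_small // addn0 modn_small.
have x1H : x1 < H by lia.
have x2H : x1 + d < H by lia.
exists (iota (x + x1) d.+1 ++ [:: v]); split.
- rewrite cat_path /= andbT; apply/andP; split; first (apply/andP; split).
  + rewrite /gadget hu ifN /enters; last by rewrite /x; lia.
    by have [-> ->] := hq _ x1H; rewrite ea /x1; apply/andP; split; lia.
  + by apply: path_run; rewrite ?(proj1 (hq _ x1H)) // /x; lia.
  + have -> : last (x + x1) (iota (x + x1).+1 d) = x + (x1 + d).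
      by rewrite (last_nth 0) size_iota -[_ :: _]/(iota _ d.+1) nth_iota // addnA.
    rewrite /gadget ifN; last by rewrite /x; lia.
    rewrite ifN; last by rewrite /x; lia.
    rewrite ifN; last by rewrite /x; lia.
    rewrite ifT; last lia. rewrite ifN; last lia.
    rewrite /leaves; have [-> ->] := hq _ x2H; rewrite eb dE.
    by apply/andP; split; lia.
- by rewrite last_cat.
- by rewrite size_cat size_iota /= /d; lia.
- rewrite all_cat; apply/andP; split; last by rewrite /= andbT; lia.
  by apply/allP => z; rewrite mem_iota /x; nia.
Qed.

End Gadget.

(** * Reading the product off approximate distances *)

Section Decode.
Variables (R : realType) (f : nat -> R).
Variables (n m ib L s W H i0 j0 k0 cA cB : nat) (a b : nat -> nat -> nat).
Hypothesis (m_gt0 : 0 < m) (s_gt0 : 0 < s) (H_def : H = L + s * W + s * W + 1).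

Let gad := gadget n m ib L s (s * W) H i0 j0 k0 (s * cA) (s * cB) a b.
Let e : rel 'I_n := fun u v => gad u v.
Let row (u : nat) := (i0 + u) %% n.
Let col (v : nat) := (j0 + (v - ib)) %% n.

Lemma gadget_walk (u v : 'I_n) p : u < ib -> ib <= v < ib + ib -> walk e u v p ->
  exists kk, [/\ kk < m, L + 2 <= size p &
    size p + s * cA + s * cB = L + 2 + s * (a (row u) kk + b kk (col v))].
Proof.
move=> hu hv /andP[hp /eqP hl].
have hp' : path gad u (map val p) by rewrite path_map.
have hl' : last (val u) (map val p) = v by rewrite last_map hl.
rewrite -hl' in hv *; rewrite -(size_map val p).
exact: path_from_source hu hp' hv.
Qed.

(** The true distance is the length of a walk, hence a shifted candidate sum scaled by [s]. The
    approximation is not smaller, so rounding the quotient down cannot fall below that candidate. *)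
Lemma gadget_decode_sound (u v : 'I_n) D d' : u < ib -> ib <= v < ib + ib ->
  is_dist e u v D -> additive_approx f D (Some d') ->
  L + 2 <= d' /\ exists2 kk, kk < m &
    a (row u) kk + b kk (col v) <= (d' - (L + 2)) %/ s + (cA + cB).
Proof.
move=> hu hv; case: D => // d [[p hp hs] _] [le _].
have [kk [h1 h2 h3]] := gadget_walk hu hv hp.
split; first lia; exists kk => //.
have : a (row u) kk + b kk (col v) - (cA + cB) <= (d' - (L + 2)) %/ s; last lia.
rewrite leq_divRL // mulnBl; lia.
Qed.

(** If both summands fit their classes, the distance [d] is at most [L + 2 + s * (la + lb) < s * M].
    The error is at most [d / M < s] and disappears in the division by [s]. *)
Lemma gadget_decode_complete (u v : 'I_n) D D' M k la lb :
  u < ib -> ib <= v < ib + ib -> is_dist e u v D -> additive_approx f D D' ->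
  0 < M -> (forall d : nat, L <= d -> (M%:R * f d <= d%:R)%R) ->
  L + 2 + s * W + s * W < s * M ->
  ib + ib + k.+1 * H <= n -> la <= W -> lb <= W ->
  a (row u) ((k0 + k) %% m) = la + cA -> b ((k0 + k) %% m) (col v) = lb + cB ->
  exists2 d', D' = Some d' & (d' - (L + 2)) %/ s + (cA + cB) <=
    a (row u) ((k0 + k) %% m) + b ((k0 + k) %% m) (col v).
Proof.
move=> hu hv hD hD' M0 hf hM hk hla hlb ea eb.
have [| | | |p [p1 p2 p3 p4]] := @gadget_path n m ib L s (s * W) H i0 j0 k0 (s * cA) (s * cB)
   a b m_gt0 H_def u v k la lb hu hv hk.
- by rewrite leq_mul2l hla orbT.
- by rewrite leq_mul2l hlb orbT.
- by rewrite ea mulnDr.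
- by rewrite eb mulnDr.
have [p' hp'] : exists p' : seq 'I_n, map val p' = p.
  elim: (p) p4 => [|z q IH] /=; first by exists [::].
  by case/andP => hz /IH[q' <-]; exists (Ordinal hz :: q').
have wk : walk e u v p'.
  apply/andP; split; last by rewrite -val_eqE -(last_map val) hp' p2.
  have : path (relpre val gad) u p' by rewrite -path_map hp'.
  by [].
have sz : size p' = L + 2 + s * (la + lb) by rewrite -(size_map val) hp'.
case: D hD hD' => [d [[q hq1 hq2] hq3]|h]; last by move: (h p'); rewrite wk.
case: D' => // d' [le1 le2]; exists d' => //.
have [_ [_ h2 _]] := gadget_walk hu hv hq1.
have {wk} := hq3 _ wk; rewrite sz hq2 in h2 * => led.
(* [d] is at least [L + 2], so [hf] applies to it. *)
have fd : (f d < s%:R)%R.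
  have M0' : (0 < M%:R :> R)%R by rewrite ltr0n.
  rewrite -(ltr_pM2l M0'); apply: le_lt_trans (hf d _) _; first lia.
  by rewrite -natrM ltr_nat; nia.
have lt : d' < d + s.
  rewrite -(ltr_nat R) natrD; apply: le_lt_trans le2 _.
  by rewrite ltrD2l.
rewrite ea eb; suff : (d' - (L + 2)) %/ s < (la + lb).+1 by lia.
by rewrite ltn_divLR // mulnC; nia.
Qed.

End Decode.

(** * The Min-Plus program *)

Notation "'OP' o r a b" := (ins (Op o r a b)) (at level 10, o, r, a, b at level 9).

(* Memory: A from 0, B from n * n, C from 2 * n * n, the graph from 3 * n * n, the
   output of the simulated program from 4 * n * n + 1, its memory from [pbase r].
   Registers: below 22 the parameters [globs], from 22 to 29 those of the current
   run [runs r], from 30 to 39 temporaries (30 is the loop counter, 31 and 32 the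
   vertices, 39 the resulting adjacency bit), 40 to 42 and from 64 on [sim]. *)
Definition set_flag : code := cseqs [:: ins (Const 39 1)].

Definition entry_source : code := cseqs [::
  OP Sub 33 32 18; OP Div 34 33 16; OP Mod 35 33 16; OP Add 34 25 34; OP Mod 34 34 2;
  OP Add 36 23 31; OP Mod 36 36 1; OP Mul 36 36 2; OP Add 36 36 34;
  ins (MemGet 36 36); OP Mul 36 12 36; OP Add 36 35 36; OP Add 37 13 26;
  ifj (Jlt 13 35) skip (cseqs [:: ifj (Jeq 36 37) set_flag skip])].

(** Registers 34 and 35 are expected to hold the path number and the position computed by
    [entry_path]. *)
Definition entry_sink : code := cseqs [::
  OP Add 34 25 34; OP Mod 34 34 2; OP Sub 36 32 17; OP Add 36 24 36; OP Mod 36 36 1;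
  OP Mul 37 34 1; OP Add 37 37 36; OP Add 37 5 37; ins (MemGet 37 37);
  OP Mul 37 12 37; OP Add 37 14 37; OP Add 36 35 27;
  ifj (Jlt 35 14) skip (cseqs [:: ifj (Jeq 36 37) set_flag skip])].

Definition entry_path : code := cseqs [::
  OP Sub 33 31 18; OP Div 34 33 16; OP Mod 35 33 16; OP Add 36 31 4;
  ifj (Jeq 32 36) (cseqs [:: OP Add 35 35 4; ifj (Jlt 35 16) set_flag skip])
    (cseqs [:: ifj (Jlt 32 18) (cseqs [:: ifj (Jlt 32 17) skip entry_sink]) skip])].

Definition entry : code := cseqs [::
  OP Div 31 30 1; OP Mod 32 30 1; ins (Const 39 0);
  ifj (Jlt 31 17) (cseqs [:: ifj (Jlt 32 18) skip entry_source])
    (cseqs [:: ifj (Jlt 31 18) skip entry_path])].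

Definition build : code := cseqs [:: ins (MemSet 7 1); ins (Const 30 0);
  while_lt 30 5 (cseqs [:: entry; OP Add 38 7 30; OP Add 38 38 4; ins (MemSet 38 39);
    OP Add 30 30 4])].

(** Register 0 holds 0, so adding it copies a register. The output area begins where the graph
    ends. *)
Definition simulate (P : program) : code :=
  cseqs [:: OP Add 40 7 0, OP Add 41 8 0 & reset P ++ [:: sim P]].

Definition min_update (c z t : nat) : seq code :=
  [:: ins (MemGet t c); ifj (Jlt z t) (cseqs [:: ins (MemSet c z)]) skip].

Definition decode : code := cseqs [:: ins (Const 30 0); OP Mul 31 17 17;
  while_lt 30 31 (cseqs [:: OP Div 32 30 17; OP Mod 33 30 17; OP Mul 34 32 1;
    OP Add 34 34 17; OP Add 34 34 33; OP Add 34 34 8; ins (MemGet 34 34);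
    ifj (Jeq 34 0) skip (cseqs ([:: OP Sub 34 34 21; OP Div 34 34 12; OP Add 34 34 28;
      OP Add 35 23 32; OP Mod 35 35 1; OP Mul 35 35 1; OP Add 36 24 33; OP Mod 36 36 1;
      OP Add 35 35 36; OP Add 35 6 35] ++ min_update 35 34 36));
    OP Add 30 30 4])].

(** A single loop treats all pairs of an inner index below [CB] and an entry of C; the index is
    reduced modulo [m] in case [m < CB]. *)
Definition brute (CB : nat) : code := cseqs [:: ins (Const 30 0); ins (Const 31 CB);
  OP Mul 31 31 5;
  while_lt 30 31 (cseqs ([:: OP Div 32 30 5; OP Mod 32 32 2; OP Mod 33 30 5;
    OP Div 34 33 1; OP Mod 35 33 1; OP Mul 36 34 2; OP Add 36 36 32; ins (MemGet 36 36);
    OP Mul 37 32 1; OP Add 37 37 35; OP Add 37 5 37; ins (MemGet 37 37); OP Add 36 36 37;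
    OP Add 33 6 33] ++ min_update 33 36 38 ++ [:: OP Add 30 30 4]))].

(** The second read into register 3 replaces [n3] by [M]. The number [2048 * CB] of runs is 4 * 4
    classes times 8 * 8 row and column blocks times [2 * CB] blocks of inner indices. Register 10 is
    doubled until it exceeds [n]. *)
Definition setup_regs (CB : nat) : code := cseqs [:: ins (Read 1); ins (Read 2); ins (Read 3);
  ins (Read 3); ins (Const 4 1); OP Mul 5 1 1; OP Add 6 5 5; OP Add 7 6 5; OP Add 8 7 5;
  OP Add 8 8 4; OP Add 29 8 5; ins (Const 9 (2048 * CB)); ins (Const 10 1); OP Add 31 1 4;
  while_lt 10 31 (cseqs [:: OP Add 10 10 10])].

(** The simulated word length is [kap] times the binary length of [n], so the modulus is the
    [kap]-th power of register 10. *)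
Definition setup_mask (kap : nat) : code := cseqs [:: ins (Const 30 0); ins (Const 32 kap);
  ins (Const 31 1); while_lt 30 32 (cseqs [:: OP Mul 31 31 10; OP Add 30 30 4])].

(** Register 21 holds [L + 3] instead of [L + 2] because [dist_word] adds 1 to finite distances. *)
Definition setup_params : code := cseqs [:: OP Add 10 31 0; OP Div 11 1 2; ins (Const 30 2);
  OP Add 31 11 30; OP Mul 31 30 31; OP Div 12 31 3; OP Add 12 12 4; ins (Const 30 4);
  OP Div 31 3 30; OP Mul 13 12 31; OP Add 14 13 11; OP Add 20 31 4; OP Mul 15 12 20;
  OP Add 16 11 13; OP Add 16 16 13; OP Add 16 16 4; OP Div 17 1 30; OP Add 18 17 17;
  OP Sub 30 1 18; OP Div 19 30 16; ins (Const 30 3); OP Add 21 11 30; ins (Const 22 0)].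

Definition load_a : code := cseqs [:: ins (Const 30 0); OP Mul 31 1 2;
  while_lt 30 31 (cseqs [:: ins (Read 32); ins (MemSet 30 32); OP Add 30 30 4])].
Definition load_b : code := cseqs [:: ins (Const 30 0); OP Mul 31 1 2;
  while_lt 30 31 (cseqs [:: ins (Read 32); OP Add 33 5 30; ins (MemSet 33 32); OP Add 30 30 4])].
(** No candidate sum exceeds [M + M], which serves as infinity. *)
Definition init_c : code := cseqs [:: ins (Const 30 0); OP Add 32 3 3;
  while_lt 30 5 (cseqs [:: OP Add 33 6 30; ins (MemSet 33 32); OP Add 30 30 4])].
Definition write_c : code := cseqs [:: ins (Const 30 0);
  while_lt 30 5 (cseqs [:: OP Add 31 6 30; ins (MemGet 31 31); ins (Write 31); OP Add 30 30 4])].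

(** The run number is split into digits of radix 4, 4, 8, 8 and a leading rest. *)
Definition setup_run : code := cseqs [:: ins (Const 30 4); OP Mod 31 22 30; OP Div 32 22 30;
  OP Mod 33 32 30; OP Div 32 32 30; ins (Const 30 8); OP Mod 34 32 30; OP Div 32 32 30;
  OP Mod 35 32 30; OP Div 32 32 30; OP Mul 23 34 17; OP Mul 24 35 17; OP Mul 25 32 19;
  OP Mul 26 15 31; OP Mul 27 15 33; OP Add 28 31 33; OP Mul 28 28 20].

Definition run (P : program) : code := cseqs [:: setup_run; build; simulate P; decode;
  cseqs [:: OP Add 29 29 10; OP Add 22 22 4]].

Definition minplus_code (P : program) (kap CB : nat) : code := cseqs [:: setup_regs CB;
  setup_mask kap; setup_params; load_a; load_b; init_c; brute CB;
  while_lt 22 9 (run P); write_c].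

(** * Tactics for symbolic execution *)

Ltac lkup := rewrite /upd /=;
  repeat match goal with H : ?g ?k = _ |- context [?g ?k] => rewrite H end.
Ltac lkin c := rewrite /upd /= in c;
  repeat match type of c with context [?g ?k] =>
    match goal with H : g k = _ |- _ => rewrite H in c end end.
(* [lia] diverges on divisions by variables, so these are abstracted first. *)
Ltac ov :=
  repeat match goal with
  | E : _ = ?e |- _ =>
      match e with context [divn _ _] => clear E | context [modn _ _] => clear E end
  end;
  repeat match goal with x := _ |- _ => clearbody x end;
  repeat match goal with
  | H : context [divn ?a ?b] |- _ => let x := fresh "x" in set x := (divn a b) in *; clearbody x
  | |- context [divn ?a ?b] => let x := fresh "x" in set x := (divn a b) in *; clearbody x
  | H : context [modn ?a ?b] |- _ => let x := fresh "x" in set x := (modn a b) in *; clearbody x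
  | |- context [modn ?a ?b] => let x := fresh "x" in set x := (modn a b) in *; clearbody x
  end; lia.
Ltac op := eapply wp_op; [lkup;
    lazymatch goal with
    | |- eval_binop _ Add _ _ = _ => apply: eval_add
    | |- eval_binop _ Mul _ _ = _ => apply: eval_mul
    | |- eval_binop _ Sub _ _ = _ => apply: eval_sub
    | |- eval_binop _ Div _ _ = _ => apply: eval_div
    | |- eval_binop _ Mod _ _ = _ => apply: eval_mod
    end;
    try ov | by [] | ].
Ltac put a z := eapply (wp_set (va := a) (vr := z)); [lkup|lkup|by []|].
Tactic Notation "get" constr(v) tactic(tac) := eapply (wp_get (v := v)); [lkup; tac | by [] |].
Lemma frame_upd c (G g : nat -> nat) r z : c <= r ->
  (forall k, k < c -> G k = g k) -> forall k, k < c -> upd G r z k = g k.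
Proof. by move=> h1 h2 k hk; rewrite /upd ifN ?h2 //; lia. Qed.

Ltac fr := repeat (apply: frame_upd; [by []|]).
Ltac frame := fr; by [].
Ltac iflt t c := apply: (wp_if_lt (t1 := t)); [by [] | move=> c; lkin c | move=> c; lkin c].
Ltac ifeq t c := apply: (wp_if_eq (t1 := t)); [by [] | move=> c; lkin c | move=> c; lkin c].

(** * Row-major order *)

Lemma idx_lt i k p q : i < p -> k < q -> i * q + k < p * q.
Proof. nia. Qed.

Lemma row_major_mkseq (T : Type) (h : nat -> T) n m :
  row_major (fun (i : 'I_n) (j : 'I_m) => h (i * m + j)) = mkseq h (n * m).
Proof.
transitivity [seq h (i * m + j) | i <- iota 0 n, j <- iota 0 m].
  rewrite -!val_enum_ord allpairs_mapl; congr flatten; apply: eq_map => i.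
  by rewrite -map_comp.
elim: n => [|n IH]; first by rewrite mul0n.
rewrite -addn1 iotaD allpairs_cat IH /= cats0 !add0n mulnDl mul1n /mkseq iotaD map_cat add0n.
have -> : iota (n * m) m = [seq n * m + j | j <- iota 0 m] by rewrite -iotaDl addn0.
by rewrite -map_comp.
Qed.

Lemma row_major_nat n m (F : 'I_n -> 'I_m -> nat) :
  {h : nat -> nat | forall i j, F i j = h (i * m + j)}.
Proof.
exists (fun t => if (insub (t %/ m), insub (t %% m)) is (Some i, Some j) then F i j else 0).
move=> i j; have m0 : 0 < m by case: m j {F} => // -[].
rewrite divnMDl // divn_small // addn0 modnMDl modn_small //.
by rewrite !valK.
Qed.

Lemma size_row_major n m (F : 'I_n -> 'I_m -> nat) : size (row_major F) = n * m.
Proof. by rewrite /row_major size_allpairs !size_enum_ord. Qed.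

Lemma nth_row_major n m (F : 'I_n -> 'I_m -> nat) (i : 'I_n) (j : 'I_m) :
  nth 0 (row_major F) (i * m + j) = F i j.
Proof.
have [h hF] := row_major_nat F.
have -> : row_major F = row_major (fun (i : 'I_n) (j : 'I_m) => h (i * m + j)).
  by congr flatten; apply: eq_map => i'; apply: eq_map => j'.
by rewrite row_major_mkseq nth_mkseq ?hF //; apply: idx_lt.
Qed.

(** Outputs are [v]-bit words, so decoding them with [w]-bit arithmetic does not overflow. *)
Lemma out_lt v P xs t : all (fun z => z < 2 ^ v) (out (iter t (step v P) (init xs))).
Proof.
set s := iter _ _ _.
suff [] : [/\ forall r, reg s r < 2 ^ v, forall c, mem s c < 2 ^ v &
  all (fun z => z < 2 ^ v) (out s)] by [].
have w0 : 0 < 2 ^ v by rewrite expn_gt0.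
rewrite {}/s; elim: t => [|t /=]; first by split.
move: (iter _ _ _) => s; rewrite /step; case: onth => // i.
case: s => p g m x y /= [h1 h2 h3].
by case: i => *; split=> //=; try (move=> z; rewrite /upd; case: eqP => // _);
  rewrite ?ltn_mod ?all_rcons ?h1 ?h2.
Qed.

(** * Correctness of the Min-Plus program *)

Section Program.
Variables (w v n m M CB kap : nat) (xa xb : seq nat).
Variables (L s W V H ib kb : nat).
Local Notation nn := (n * n).
Local Notation mask := (2 ^ v).
Hypothesis (m_gt0 : 0 < m) (mn : m <= n) (vw : v < w).
Hypothesis (sz_xa : size xa = n * m) (sz_xb : size xb = m * n).
Hypothesis (xa_le : forall t, nth 0 xa t <= M) (xb_le : forall t, nth 0 xb t <= M).
Hypothesis (L_def : L = n %/ m) (s_def : s = (2 * (L + 2)) %/ M + 1) (W_def : W = M %/ 4).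
Hypothesis (V_def : V = W + 1) (H_def : H = L + s * W + s * W + 1).
Hypothesis (ib_def : ib = n %/ 4) (kb_def : kb = (n - (ib + ib)) %/ H).
(** Room for sums and addresses, for the counter of [brute], for the memory blocks of all runs, and
    for the literal [kap]. *)
Hypothesis (cap1 : 100 * (nn + M + 1) + mask < 2 ^ w).
Hypothesis (cap2 : 100 * (CB + 1) * nn < 2 ^ w).
Hypothesis (cap3 : 5 * nn + 1 + (2048 * CB + 2) * mask < 2 ^ w).
Hypothesis (cap4 : kap < 2 ^ w).

Definition ma i k := nth 0 xa (i * m + k).
Definition mb k j := nth 0 xb (k * n + j).

Arguments ma : simpl never.
Arguments mb : simpl never.

Definition globs : seq nat :=
  [:: 0; n; m; M; 1; nn; nn + nn; nn + nn + nn; nn + nn + nn + nn + 1; 2048 * CB; mask;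
   L; s; s * W; s * W + L; s * V; H; ib; ib + ib; kb; V; L + 3].

Definition pbase r := nn + nn + nn + nn + 1 + nn + r * mask.
(* Run [r] treats entry classes [rA r] of A and [rB r] of B, and blocks [rI r] of rows,
   [rJ r] of columns and [rK r] of inner indices. *)
Definition rA r := r %% 4.
Definition rB r := r %/ 4 %% 4.
Definition rI r := r %/ 4 %/ 4 %% 8.
Definition rJ r := r %/ 4 %/ 4 %/ 8 %% 8.
Definition rK r := r %/ 4 %/ 4 %/ 8 %/ 8.
Definition runs r : seq nat :=
  [:: r; rI r * ib; rJ r * ib; rK r * kb; s * V * rA r; s * V * rB r;
      (rA r + rB r) * V; pbase r].

Lemma sM_le : s * M <= 2 * (L + 2) + M.
Proof.
rewrite s_def mulnDl mul1n leq_add2r; exact: leq_trunc_div.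
Qed.

Lemma s_gt0 : 0 < s. Proof. by rewrite s_def addn1. Qed.
Lemma s_le : s <= 2 * (L + 2) + 1.
Proof. by rewrite s_def leq_add2r; apply: leq_div. Qed.
Lemma sW_le : 4 * (s * W) <= s * M.
Proof. by rewrite mulnCA leq_mul2l W_def mulnC leq_trunc_div orbT. Qed.
Lemma L_le : L <= n. Proof. by rewrite L_def; apply: leq_div. Qed.
Lemma L_gt0 : 0 < L. Proof. by rewrite L_def divn_gt0. Qed.
Lemma n_gt0 : 0 < n. Proof. exact: leq_trans m_gt0 mn. Qed.
Lemma n_le : n <= nn. Proof. by rewrite leq_pmull // n_gt0. Qed.
Lemma H_le : 2 * H <= 4 * L + M + 10.
Proof. have := sW_le; have := sM_le; lia. Qed.
Lemma nm_le : n * m <= nn. Proof. by rewrite leq_mul2l mn orbT. Qed.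
Lemma ib_le : 4 * ib <= n. Proof. by rewrite ib_def mulnC leq_trunc_div. Qed.
Lemma kb_le : kb <= n. Proof. by rewrite kb_def; apply: leq_trans (leq_div _ _) (leq_subr _ _). Qed.

Definition mem_ab (mm : nat -> nat) : Prop :=
  (forall t, t < n * m -> mm t = nth 0 xa t) /\
  (forall t, t < n * m -> mm (nn + t) = nth 0 xb t).

(** Every branch of the adjacency test is followed symbolically; the bounds on offsets and shifts
    exclude overflow. *)
Lemma entry_ok i0 j0 k0 tA tB t g mm x y :
  i0 <= 2 * n -> j0 <= 2 * n -> k0 <= 2 * CB * nn ->
  tA <= 3 * (s * V) -> tB <= 3 * (s * V) -> t < nn ->
  (forall k, k < 22 -> g k = nth 0 globs k) ->
  g 23 = i0 -> g 24 = j0 -> g 25 = k0 -> g 26 = tA -> g 27 = tB ->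
  g 30 = t -> mem_ab mm ->
  wp w entry 80 (fun g' m' x' y' =>
    [/\ g' 39 = gadget n m ib L s (s * W) H i0 j0 k0 tA tB ma mb (t %/ n) (t %% n),
        forall k, k < 31 -> g' k = g k, m' = mm, x' = x & y' = y]) g mm x y.
Proof.
move=> hi0 hj0 hk0 htA htB ht hg e23 e24 e25 e26 e27 e30 [hA hB].
have b1 := sM_le; have b2 := s_le; have b3 := sW_le; have b4 := L_le; have b5 := n_le.
have b6 := H_le; have b7 := nm_le; have b8 := ib_le; have b10 := n_gt0.
have b11 : s * V = s * W + s by rewrite V_def mulnDr muln1.
have b12 : s * V <= s * M + s by lia.
have hu : t %/ n < n by rewrite ltn_divLR.
have hv : t %% n < n by rewrite ltn_mod.
have e1 := hg 1 isT; have e2 := hg 2 isT; have e4 := hg 4 isT; have e5 := hg 5 isT.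
have e12 := hg 12 isT; have e13 := hg 13 isT; have e14 := hg 14 isT; have e16 := hg 16 isT.
have e17 := hg 17 isT; have e18 := hg 18 isT.
rewrite /= in e1 e2 e4 e5 e12 e13 e14 e16 e17 e18.
have capk : k0 + n < 2 ^ w by lia.
have capm z : z <= M -> s * z <= s * M by move=> h; rewrite leq_mul2l h orbT.
clear L_def s_def W_def V_def H_def ib_def kb_def cap2 cap3 cap4.
rewrite /entry; op; op.
set u := t %/ n in hu *; set z := t %% n in hv *.
apply: wp_const => //; first lia.
iflt 70 c1.
- iflt 60 c2.
    repeat apply: wp_skip; split=> //; last by frame.
    by rewrite /upd /= /gadget c1 c2.
  rewrite /entry_source; op.
  set q := z - (ib + ib).
  have hq : q < n by lia.
  have hqH : q %/ H <= q by apply: leq_div.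
  have hqH' : q %% H <= q by apply: leq_mod.
  op; op; op; op; op; op.
  set k := (k0 + _) %% m; set i := (i0 + u) %% n.
  have hk : k < m by rewrite ltn_mod.
  have hi : i < n by rewrite ltn_mod.
  have hik := idx_lt hi hk.
  op; op; get (ma i k) (rewrite hA //).
  have hma := capm _ (xa_le (i * m + k)); rewrite -/(ma i k) in hma.
  op; op; op.
  iflt 10 c3.
    repeat apply: wp_skip; split=> //; last by frame.
    by rewrite /upd /= /gadget c1 ifN ?/enters -?leqNgt // -/q leqNgt c3.
  ifeq 5 c4.
    apply: wp_const => //; first ov.
    repeat apply: wp_skip; split=> //; last by frame.
    by rewrite /upd /= /gadget c1 ifN ?/enters -?leqNgt // -/q /mid c3 -/k -/i c4 eqxx.
  repeat apply: wp_skip; split=> //; last by frame.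
  rewrite /upd /= /gadget c1 ifN ?/enters -?leqNgt // -/q /mid c3 -/k -/i /=.
  by case: eqP.
- iflt 60 c2.
    repeat apply: wp_skip; split=> //; last by frame.
    by rewrite /upd /= /gadget ltnNge c1 /= c2.
  rewrite /entry_path; op.
  set q := u - (ib + ib).
  have hq : q < n by lia.
  have hqH : q %/ H <= q by apply: leq_div.
  have hqH' : q %% H <= q by apply: leq_mod.
  have gE : gadget n m ib L s (s * W) H i0 j0 k0 tA tB ma mb u z =
    if z == u.+1 then (q %% H).+1 < H else
    if z < ib + ib then if z < ib then false
      else leaves n m L s (s * W) H j0 k0 tB mb q (z - ib) else false.
    by rewrite /gadget [u < ib]ltnNge c1 /= [u < ib + ib]ltnNge c2.
  rewrite gE {gE}; op; op; op.
  ifeq 40 c3.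
    op; iflt 5 c4.
      apply: wp_const => //; first ov.
      repeat apply: wp_skip; split=> //; last by frame.
      by rewrite addn1 in c4; rewrite /upd /= c3 addn1 eqxx c4.
    repeat apply: wp_skip; split=> //; last by frame.
    by rewrite addn1 in c4; rewrite /upd /= c3 addn1 eqxx ltnNge c4.
  have -> : (z == u.+1) = false by apply/eqP => h; apply: c3; rewrite h addn1.
  iflt 36 c4; last first.
    repeat apply: wp_skip; split=> //; last by frame.
    by rewrite /upd /= ltnNge c4.
  rewrite c4; iflt 32 c5.
    repeat apply: wp_skip; split=> //; last by frame.
    by rewrite /upd /= c5.
  rewrite ltnNge c5 /= /entry_sink; op; op; op; op; op.
  set k := (k0 + _) %% m; set j := (j0 + _) %% n.
  have hk : k < m by rewrite ltn_mod.
  have hj : j < n by rewrite ltn_mod.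
  have hkj := idx_lt hk hj.
  have mnC := mulnC n m.
  op; op; op; get (mb k j) (rewrite hB //; ov).
  have hmb := capm _ (xb_le (k * n + j)); rewrite -/(mb k j) in hmb.
  op; op; op.
  rewrite /leaves /mid -/k -/j.
  iflt 9 c6.
    repeat apply: wp_skip; split=> //; last by frame.
    by rewrite /upd /= leqNgt c6.
  rewrite c6; ifeq 5 c7.
    apply: wp_const => //; first ov.
    repeat apply: wp_skip; split=> //; last by frame.
    by rewrite /upd /= c7 eqxx.
  repeat apply: wp_skip; split=> //; last by frame.
  by rewrite /upd /=; case: eqP.
Qed.

Lemma build_ok i0 j0 k0 tA tB g mm x y :
  i0 <= 2 * n -> j0 <= 2 * n -> k0 <= 2 * CB * nn ->
  tA <= 3 * (s * V) -> tB <= 3 * (s * V) ->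
  (forall k, k < 22 -> g k = nth 0 globs k) ->
  g 23 = i0 -> g 24 = j0 -> g 25 = k0 -> g 26 = tA -> g 27 = tB -> mem_ab mm ->
  wp w build (10 + nn * 90) (fun g' m' x' y' =>
    [/\ forall k, k < 30 -> g' k = g k,
        m' (nn + nn + nn) = n /\ (forall t, t < nn -> m' (nn + nn + nn + 1 + t) =
          gadget n m ib L s (s * W) H i0 j0 k0 tA tB ma mb (t %/ n) (t %% n)),
        forall c, c < nn + nn + nn \/ nn + nn + nn + nn + 1 <= c -> m' c = mm c,
        x' = x & y' = y]) g mm x y.
Proof.
move=> hi0 hj0 hk0 htA htB hg e23 e24 e25 e26 e27 hab.
have e1 := hg 1 isT; have e4 := hg 4 isT; have e5 := hg 5 isT; have e7 := hg 7 isT.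
rewrite /= in e1 e4 e5 e7; have b7 := nm_le.
rewrite /build; put (nn + nn + nn) n => //.
apply: wp_const => //; first ov.
apply: (wp_cseqs (t1 := nn * 88 + 2)); first ov.
apply: (wp_while (N := nn) (tb := 86) (Inv := fun t g' m' x' y' =>
  [/\ g' 30 = t /\ forall k, k < 30 -> g' k = g k,
      m' (nn + nn + nn) = n /\ (forall t', t' < t -> m' (nn + nn + nn + 1 + t') =
          gadget n m ib L s (s * W) H i0 j0 k0 tA tB ma mb (t' %/ n) (t' %% n)),
      forall c, c < nn + nn + nn \/ nn + nn + nn + nn + 1 <= c -> m' c = mm c,
      x' = x & y' = y])).
- split=> //.
  + by split=> //; frame.
  + by rewrite /upd eqxx.
  + by move=> c hc; rewrite /upd ifN //; ov.
- move=> t g1 m1 x1 y1 ht [[h30 hfr] [hn hG] hm -> ->].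
  rewrite h30 hfr // e5; split=> //.
  apply: (wp_cseqs (t1 := 80)) => //; apply: wp_weaken (leqnn _) _.
    apply: (entry_ok _ _ hi0 hj0 hk0 htA htB ht) => //; rewrite ?hfr //.
      by move=> k hk; rewrite hfr ?hg //; ov.
    by case: hab => hA hB; split=> c hc; rewrite hm; [exact: hA|ov|exact: hB|ov].
  move=> g2 m2 x2 y2 [h39 hfr2 -> -> ->].
  have f30 := hfr2 30 isT; have f7 := hfr2 7 isT; have f4 := hfr2 4 isT.
  rewrite h30 in f30; rewrite hfr // e7 in f7; rewrite hfr // e4 in f4.
  op; op; eapply wp_set; [reflexivity|reflexivity|by []|]; op.
  apply: wp_skip; split=> //.
  + split; first by rewrite /upd /=; ov.
    by fr; move=> k hk; rewrite hfr2 ?hfr //; ov.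
  + split; first by rewrite /upd /= ifN ?hn //; ov.
    move=> t' ht'; rewrite {1}/upd /= /upd /=.
    have [->|ne] := eqVneq t' t.
      by rewrite ifT ?h39 //; ov.
    by rewrite ifN ?hG //; ov.
  + by move=> c hc; rewrite /upd /= ifN ?hm //; ov.
- move=> g1 m1 x1 y1 [[h30 hfr] hG hm -> ->].
  rewrite h30 hfr // e5; split=> //; apply: wp_skip; split=> //.
Qed.

Lemma simulate_ok P xs ys t pb g mm x y :
  g 0 = 0 -> g 4 = 1 -> g 7 = nn + nn + nn -> g 8 = nn + nn + nn + nn + 1 ->
  g 10 = mask -> g 29 = pb ->
  nn + nn + nn + nn + 1 + nn <= pb -> pb + mask < 2 ^ w ->
  size xs = nn.+1 -> (forall i, i < nn.+1 -> mm (nn + nn + nn + i) = nth 0 xs i) ->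
  (forall c, pb <= c -> mm c = 0) ->
  computes_within v P xs t ys -> size ys <= nn ->
  wp w (simulate P) (2 + size (prog_regs P) + t * 6) (fun g' m' x' y' =>
    [/\ forall k, k < 40 -> g' k = g k,
        forall c, c < nn + nn + nn + nn + 1 \/ pb + mask <= c -> m' c = mm c,
        forall i, i < size ys -> m' (nn + nn + nn + nn + 1 + i) = nth 0 ys i,
        x' = x & y' = y]) g mm x y.
Proof.
move=> e0 e4 e7 e8 e10 e29 hpb hpw sxs hxs hz hcw sys.
rewrite /simulate -addnA; op; op; rewrite !addn0.
apply: wp_reset_regs => /=; first exact: leq_addr.
move=> g1 h1 h2; rewrite (_ : _ - _ = t * 6); last ov.
apply: (wp_cseqs (leqnn _)); rewrite subnn.
have g1E k : k < 40 -> g1 k = g k by move=> hk; rewrite h1; [move: k hk; frame|ov].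
apply: (@wp_sim P v w vw g1 mm xs (nn + nn + nn) (nn + nn + nn + nn + 1) pb nn _ _ _ _ _ _ _ _
   _ g1 x y xs ys t) => //; rewrite ?g1E //.
- by rewrite sxs; ov.
- by rewrite sxs => i; apply: hxs.
- split=> //=.
  + by move=> r; rewrite h2 => ->.
  + by split=> _; rewrite expn_gt0.
  + by move=> c hc; rewrite hz //; ov.
  + by exists 0; rewrite drop0 h1 ?addn0.
  + by split=> //; rewrite h1 // addn0.
- move=> g' m' k1 k2 k3; apply: wp_skip; split=> // k hk.
  by rewrite k1 ?g1E.
Qed.

(** * Candidate sums and the minima recorded so far *)

Definition tri t kk := ma (t %/ n) kk + mb kk (t %% n).

(* [S t kk]: the inner index [kk] has been taken into account for entry [t] of C. *)
Definition memok (S : nat -> nat -> Prop) (mm : nat -> nat) : Prop :=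
  [/\ mem_ab mm,
      forall t, t < nn -> exists2 kk, kk < m & tri t kk <= mm (nn + nn + t) &
      forall t kk, t < nn -> S t kk -> mm (nn + nn + t) <= tri t kk].

Lemma memok_frame S mm mm' : (forall c, c < nn + nn + nn -> mm' c = mm c) ->
  memok S mm -> memok S mm'.
Proof.
move=> h [[hA hB] h1 h2]; have b7 := nm_le; split.
- by split=> t ht; rewrite h; [exact: hA|ov|exact: hB|ov].
- by move=> t ht; rewrite h; [exact: h1|ov].
- by move=> t kk ht; rewrite h; [exact: h2|ov].
Qed.

(** The new value dominates some candidate, so it is not below the minimum; being smaller than the
    old one, it keeps every bound already reached. *)
Lemma memok_upd (S S' : nat -> nat -> Prop) mm t0 c : memok S mm -> t0 < nn ->
  (exists2 kk, kk < m & tri t0 kk <= c) -> c < mm (nn + nn + t0) ->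
  (forall t kk, S' t kk -> S t kk \/ t = t0 /\ c <= tri t kk) ->
  memok S' (upd mm (nn + nn + t0) c).
Proof.
move=> [[hA hB] h1 h2] ht0 hc lt hS; have b7 := nm_le; split.
- by split=> t ht; rewrite /upd ifN; [exact: hA|ov|exact: hB|ov].
- move=> t ht; rewrite /upd eqn_add2l; case: eqP => [->//|_]; exact: h1.
- move=> t kk ht /hS; rewrite /upd eqn_add2l; case: eqP => [->|ne].
    by case=> [hs|[]//]; apply: leq_trans (ltnW lt) (h2 _ _ ht0 hs).
  by case=> [hs|[]//]; apply: h2.
Qed.

Lemma memok_keep (S S' : nat -> nat -> Prop) mm t0 c : memok S mm ->
  mm (nn + nn + t0) <= c ->
  (forall t kk, S' t kk -> S t kk \/ t = t0 /\ c <= tri t kk) -> memok S' mm.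
Proof.
move=> [hab h1 h2] le hS; split=> // t kk ht /hS[|[-> h]]; first exact: h2.
exact: leq_trans le h.
Qed.

Lemma min_update_ok (S S' : nat -> nat -> Prop) cs t0 c cr zr tr t Q g mm x y :
  g cr = nn + nn + t0 -> g zr = c -> (cr == tr) = false -> (zr == tr) = false ->
  memok S mm -> t0 < nn -> (exists2 kk, kk < m & tri t0 kk <= c) ->
  (forall t kk, S' t kk -> S t kk \/ t = t0 /\ c <= tri t kk) -> 4 <= t ->
  (forall m', memok S' m' -> (forall d, d < nn + nn \/ nn + nn + nn <= d -> m' d = mm d) ->
     wp w (cseqs cs) (t - 4) Q (upd g tr (mm (nn + nn + t0))) m' x y) ->
  wp w (cseqs (min_update cr zr tr ++ cs)) t Q g mm x y.
Proof.
move=> ec ez n1 n2 hm ht0 hc hS le4 HQ; have t0' : 0 < t by ov.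
eapply wp_get; [by rewrite ec|by []|].
apply: (wp_if_lt (t1 := 1)); first ov.
- rewrite /upd n2 eqxx ez => lt.
  eapply wp_set; [by rewrite /upd n1 ec|by rewrite /upd n2 ez|by []|].
  apply: wp_skip; have -> : t.-1 - 3 = t - 4 by ov.
  apply: HQ; first exact: memok_upd hm ht0 hc lt hS.
  by move=> d hd; rewrite /upd ifN //; ov.
- rewrite /upd n2 eqxx ez => le; apply: wp_skip; have -> : t.-1 - 3 = t - 4 by ov.
  by apply: HQ => //; apply: memok_keep hm le hS.
Qed.


(** A pair of a row [u] and a column [q] of the current blocks is numbered [z = u * ib + q];
    [dec_src] locates its distance in the output, [dec_tgt] its entry of C. *)
Definition dec_src z := z %/ ib * n + ib + z %% ib.
Definition dec_tgt i0 j0 z := (i0 + z %/ ib) %% n * n + (j0 + z %% ib) %% n.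
Arguments dec_src : simpl never.
Arguments dec_tgt : simpl never.

(** The assumption on nonzero words makes every update sound, and an index is accounted for as soon
    as its sum is at least the decoded value. The word 0 is an infinite distance and is skipped. *)
Lemma decode_ok S (wd : nat -> nat) i0 j0 cAB g mm x y :
  (forall k, k < 22 -> g k = nth 0 globs k) ->
  g 23 = i0 -> g 24 = j0 -> g 28 = cAB -> i0 <= 2 * n -> j0 <= 2 * n -> cAB <= 6 * V ->
  (forall i, i < nn -> mm (nn + nn + nn + nn + 1 + i) = wd i /\ wd i < mask) ->
  (forall z, z < ib * ib -> wd (dec_src z) <> 0 -> L + 3 <= wd (dec_src z) /\
     exists2 kk, kk < m & tri (dec_tgt i0 j0 z) kk <= (wd (dec_src z) - (L + 3)) %/ s + cAB) ->
  memok S mm ->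
  wp w decode (10 + nn * 50) (fun g' m' x' y' =>
    [/\ forall k, k < 30 -> g' k = g k,
        memok (fun t kk => S t kk \/ exists2 z, z < ib * ib &
          [/\ t = dec_tgt i0 j0 z, wd (dec_src z) <> 0 &
              (wd (dec_src z) - (L + 3)) %/ s + cAB <= tri t kk]) m',
        forall c, nn + nn + nn <= c -> m' c = mm c,
        x' = x & y' = y]) g mm x y.
Proof.
move=> hg e23 e24 e28 hi0 hj0 hcAB hwd hsound hok.
have b4 := L_le; have b5 := n_le; have b8 := ib_le; have b10 := n_gt0.
have b11 : V <= M + 1 by rewrite V_def W_def leq_add2r; apply: leq_div.
have b12 : ib * ib <= nn by apply: leq_mul; ov.
have e0 := hg 0 isT; have e1 := hg 1 isT; have e4 := hg 4 isT; have e6 := hg 6 isT.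
have e8 := hg 8 isT; have e12 := hg 12 isT; have e17 := hg 17 isT; have e21 := hg 21 isT.
rewrite /= in e0 e1 e4 e6 e8 e12 e17 e21.
rewrite /decode; apply: wp_const => //; first ov.
op.
apply: (wp_cseqs (t1 := ib * ib * 50 + 2)); first ov.
apply: (wp_while (N := ib * ib) (tb := 48) (Inv := fun t g' m' x' y' =>
  [/\ [/\ g' 30 = t, g' 31 = ib * ib & forall k, k < 30 -> g' k = g k],
      memok (fun t' kk => S t' kk \/ exists2 z, z < t &
          [/\ t' = dec_tgt i0 j0 z, wd (dec_src z) <> 0 &
              (wd (dec_src z) - (L + 3)) %/ s + cAB <= tri t' kk]) m',
      forall c, nn + nn + nn <= c -> m' c = mm c,
      x' = x & y' = y])).
- split=> //; first by split=> //; frame.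
  case: hok => h1 h2 h3; split=> // t kk ht [|[z]]; last by [].
  exact: h3.
- move=> z g1 m1 x1 y1 hz [[h30 h31 hfr] hok1 hm -> ->].
  rewrite h30 h31; split=> //.
  have f0 := hfr 0 isT; have f1 := hfr 1 isT; have f4 := hfr 4 isT; have f6 := hfr 6 isT.
  have f8 := hfr 8 isT; have f12 := hfr 12 isT; have f17 := hfr 17 isT.
  have f21 := hfr 21 isT; have f23 := hfr 23 isT; have f24 := hfr 24 isT.
  have f28 := hfr 28 isT.
  rewrite e0 in f0; rewrite e1 in f1; rewrite e4 in f4; rewrite e6 in f6; rewrite e8 in f8.
  rewrite e12 in f12; rewrite e17 in f17; rewrite e21 in f21; rewrite e23 in f23.
  rewrite e24 in f24; rewrite e28 in f28.
  have hu : z %/ ib < ib by rewrite ltn_divLR //; case: (ib) hz.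
  have hv : z %% ib < ib by rewrite ltn_mod; case: (ib) hz.
  have hsrc : dec_src z < nn.
    rewrite /dec_src -addnA; apply: idx_lt; ov.
  op; op.
  set u := z %/ ib in hu *; set q := z %% ib in hv *.
  have srcE : dec_src z = u * n + ib + q by [].
  op; op; op; op.
  get (wd (dec_src z)) (rewrite hm; [rewrite addnC -srcE; exact: (proj1 (hwd _ hsrc))|ov]).
  have [_ hwm] := hwd _ hsrc.
  ifeq 30 c1.
    apply: wp_skip; op; apply: wp_skip; split=> //.
    + split; [by rewrite /upd /=; ov|by []|by fr].
    + case: hok1 => k1 k2 k3; split=> // t kk ht [hs|[z' hz' [hz1 hz2 hz3]]].
        by apply: k3 => //; left.
      apply: k3 => //; right; exists z' => //.
      by have [e|] := eqVneq z' z; [case: hz2; rewrite e|ov].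
  have [hs1 hs2] := hsound z hz c1.
  set W0 := wd (dec_src z) in hwm hs1 hs2 c1 *.
  op.
  have hdv : (W0 - (L + 3)) %/ s <= W0 - (L + 3) by apply: leq_div.
  op; op; op; op.
  set i := (i0 + u) %% n; have hi : i < n by rewrite ltn_mod.
  have hin : i * n < nn by rewrite ltn_pmul2r.
  op; op; op.
  set j := (j0 + q) %% n; have hj : j < n by rewrite ltn_mod.
  have hij := idx_lt hi hj.
  op; op.
  have tE : dec_tgt i0 j0 z = i * n + j by [].
  rewrite -[min_update _ _ _]cats0.
  apply: (min_update_ok (S := fun t' kk => S t' kk \/ exists2 z', z' < z &
          [/\ t' = dec_tgt i0 j0 z', wd (dec_src z') <> 0 &
              (wd (dec_src z') - (L + 3)) %/ s + cAB <= tri t' kk])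
      (S' := fun t' kk => S t' kk \/ exists2 z', z' < z.+1 &
          [/\ t' = dec_tgt i0 j0 z', wd (dec_src z') <> 0 &
              (wd (dec_src z') - (L + 3)) %/ s + cAB <= tri t' kk])
      (t0 := i * n + j) (c := (W0 - (L + 3)) %/ s + cAB)) => //.
    move=> t' kk [|[z' hz' [k1 k2 k3]]]; first by left; left.
    have [e|ne] := eqVneq z' z; first by right; rewrite k1 e tE in k3 *.
    by left; right; exists z' => //; ov.
  move=> m2 hok2 hm2; apply: wp_skip; op; apply: wp_skip; split=> //.
  + split; [by rewrite /upd /=; ov|by []|by fr].
  + by move=> c hc; rewrite hm2 ?hm //; right.
- move=> g1 m1 x1 y1 [[h30 h31 hfr] hok1 hm -> ->].
  by rewrite h30 h31; split=> //; apply: wp_skip; split.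
Qed.


Lemma brute_ok S g mm x y : 0 < CB ->
  (forall k, k < 22 -> g k = nth 0 globs k) -> memok S mm ->
  wp w (brute CB) (10 + CB * nn * 30) (fun g' m' x' y' =>
    [/\ forall k, k < 30 -> g' k = g k,
        memok (fun t kk => kk < m /\ kk < CB) m',
        forall c, nn + nn + nn <= c -> m' c = mm c,
        x' = x & y' = y]) g mm x y.
Proof.
move=> CB0 hg hok.
have b5 := n_le; have b7 := nm_le; have b10 := n_gt0.
have e1 := hg 1 isT; have e2 := hg 2 isT; have e4 := hg 4 isT; have e5 := hg 5 isT.
have e6 := hg 6 isT; rewrite /= in e1 e2 e4 e5 e6.
have nn0 : 0 < nn by rewrite muln_gt0 b10.
have CBnn : CB * nn < 2 ^ w by apply: leq_ltn_trans cap2; rewrite leq_mul2r; apply/orP; right; ov.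
rewrite /brute; apply: wp_const => //; first ov.
apply: wp_const => //; first by apply: leq_ltn_trans CBnn; apply: leq_pmulr.
op.
apply: (wp_cseqs (t1 := CB * nn * 30 + 2)); first ov.
apply: (wp_while (N := CB * nn) (tb := 28) (Inv := fun t g' m' x' y' =>
  [/\ [/\ g' 30 = t, g' 31 = CB * nn & forall k, k < 30 -> g' k = g k],
      memok (fun t' kk => exists2 z, z < t & t' = z %% nn /\ kk = z %/ nn %% m) m',
      forall c, nn + nn + nn <= c -> m' c = mm c,
      x' = x & y' = y])).
- split=> //; first by split=> //; frame.
  by case: hok => h1 h2 h3; split=> // t kk ht [z].
- move=> z g1 m1 x1 y1 hz [[h30 h31 hfr] hok1 hm -> ->].
  rewrite h30 h31; split=> //.
  have f1 := hfr 1 isT; have f2 := hfr 2 isT; have f4 := hfr 4 isT; have f5 := hfr 5 isT.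
  have f6 := hfr 6 isT.
  rewrite e1 in f1; rewrite e2 in f2; rewrite e4 in f4; rewrite e5 in f5; rewrite e6 in f6.
  have hd : z %/ nn <= z by apply: leq_div.
  op; op; op.
  set kk := z %/ nn %% m; set t0 := z %% nn.
  have hk : kk < m by rewrite ltn_mod.
  have ht : t0 < nn by rewrite ltn_mod.
  have hi : t0 %/ n < n by rewrite ltn_divLR.
  have hj : t0 %% n < n by rewrite ltn_mod.
  have hik := idx_lt hi hk; have hkj := idx_lt hk hj; have mnC := mulnC n m.
  have him : t0 %/ n * m <= n * m by rewrite leq_mul2r (ltnW hi) orbT.
  have hkn : kk * n <= m * n by rewrite leq_mul2r (ltnW hk) orbT.
  have [[hA hB] _ _] := hok1.
  have hma := xa_le (t0 %/ n * m + kk); have hmb := xb_le (kk * n + t0 %% n).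
  rewrite -/(ma _ _) in hma; rewrite -/(mb _ _) in hmb.
  op; op; op; op.
  get (ma (t0 %/ n) kk) (rewrite hA //).
  op; op; op; get (mb kk (t0 %% n)) (rewrite hB //; ov).
  op; op.
  apply: (min_update_ok (S := fun t' kk => exists2 z', z' < z & t' = z' %% nn /\ kk = z' %/ nn %% m)
     (S' := fun t' kk => exists2 z', z' < z.+1 & t' = z' %% nn /\ kk = z' %/ nn %% m)
      (t0 := t0) (c := tri t0 kk)) => //.
    by exists kk.
    move=> t' k' [z' hz' [k1 k2]].
    have [e|ne] := eqVneq z' z; first by right; rewrite k1 k2 e.
    by left; exists z' => //; ov.
  move=> m2 hok2 hm2; op; apply: wp_skip; split=> //.
  + split; [by rewrite /upd /=; ov|by []|by fr].
  + by move=> c hc; rewrite hm2 ?hm //; right.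
- move=> g1 m1 x1 y1 [[h30 h31 hfr] hok1 hm -> ->].
  rewrite h30 h31; split=> //; apply: wp_skip; split=> //.
  case: hok1 => h1 h2 h3; split=> // t kk ht [k1 k2]; apply: h3 => //.
  (* The round in which [kk] and [t] are treated; as [kk < m], the reduction modulo [m] does not
     change it. *)
  exists (kk * nn + t); first exact: idx_lt.
  by rewrite modnMDl divnMDl // divn_small // addn0 !modn_small.
Qed.

(** * Initialisation, input and output *)

Lemma setup_regs_ok lam xs y : n < 2 ^ lam -> (forall k, k < lam -> 2 ^ k <= n) -> lam <= n ->
  wp w (setup_regs CB) (20 + nn * 3) (fun g' m' x' y' =>
    [/\ forall k, k < 10 -> g' k = nth 0 globs k, g' 10 = 2 ^ lam, g' 29 = pbase 0,
        m' = (fun=> 0) & x' = xs /\ y' = y]) (fun=> 0) (fun=> 0) [:: n, m, n, M & xs] y.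
Proof.
move=> hl1 hl2 hl3; have b5 := n_le; have w0 : 0 < 2 ^ v by rewrite expn_gt0.
have c2 : 2048 * CB < 2 ^ w.
  apply: leq_ltn_trans cap3; apply: leq_trans (leq_addl _ _).
  exact: leq_trans (leq_addr 2 _) (leq_pmulr _ w0).
rewrite /setup_regs.
apply: wp_read; [by []|ov|by []|]; apply: wp_read; [by []|ov|by []|].
apply: wp_read; [by []|ov|by []|]; apply: wp_read; [by []|ov|by []|].
apply: wp_const => //; first ov.
op; op; op; op; op; op.
apply: wp_const => //; apply: wp_const => //; first ov.
op.
apply: (wp_cseqs (t1 := lam * 3 + 2)); first ov.
(* The hypotheses on [lam] make the doubling loop run exactly [lam] times. *)
apply: (wp_while (N := lam) (tb := 1) (Inv := fun t g' m' x' y' =>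
    [/\ forall k, k < 10 -> g' k = nth 0 globs k, g' 10 = 2 ^ t /\ g' 31 = n + 1,
        g' 29 = pbase 0, m' = (fun=> 0) & x' = xs /\ y' = y])).
- split=> //; last by rewrite /upd /= /pbase; ov.
  by move=> k; do 10 (case: k => [|k]; first by []).
- move=> t g1 m1 x1 y1 ht [h1 [h2 h3] h4 -> [-> ->]]; have hp := hl2 _ ht.
  rewrite h2 h3; split; first ov.
  op; apply: wp_skip; split=> //; first by fr.
  by split=> //; rewrite /upd /= expnS; ov.
- move=> g1 m1 x1 y1 [h1 [h2 h3] h4 -> [-> ->]].
  by rewrite h2 h3; split; [ov|apply: wp_skip; split].
Qed.

Lemma setup_mask_ok lam g mm x y : v = kap * lam -> g 4 = 1 -> g 10 = 2 ^ lam ->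
  wp w (setup_mask kap) (10 + kap * 5) (fun g' m' x' y' =>
    [/\ forall k, k < 30 -> g' k = g k, g' 31 = mask, m' = mm, x' = x & y' = y]) g mm x y.
Proof.
move=> hv e4 e10; have w1 : 1 < 2 ^ w by ov.
rewrite /setup_mask; apply: wp_const => //; first ov.
apply: wp_const => //; apply: wp_const => //.
apply: (wp_cseqs (t1 := kap * 4 + 2)); first ov.
apply: (wp_while (N := kap) (tb := 2) (Inv := fun t g' m' x' y' =>
    [/\ forall k, k < 30 -> g' k = g k, [/\ g' 30 = t, g' 31 = 2 ^ (lam * t) & g' 32 = kap],
    m' = mm, x' = x & y' = y])).
- by split=> //; [frame|split=> //; rewrite muln0].
- move=> t g1 m1 x1 y1 ht [h1 [h2 h3 h4] -> -> ->].
  rewrite h2 h4; split=> //.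
  have f4 := h1 4 isT; have f10 := h1 10 isT; rewrite e4 in f4; rewrite e10 in f10.
  have hp : 2 ^ (lam * t) * 2 ^ lam <= mask.
    by rewrite -expnD leq_exp2l // hv -mulnSr mulnC leq_mul2r ht orbT.
  op; op; apply: wp_skip; split=> //; first by frame.
  by split=> //; rewrite /upd /= -?expnD -?mulnSr //; ov.
- move=> g1 m1 x1 y1 [h1 [h2 h3 h4] -> -> ->].
  by rewrite h2 h4; split=> //; apply: wp_skip; split=> //; rewrite h3 hv mulnC.
Qed.

Lemma setup_params_ok g mm x y : (forall k, k < 10 -> g k = nth 0 globs k) -> g 31 = mask ->
  wp w setup_params 30 (fun g' m' x' y' =>
    [/\ forall k, k < 22 -> g' k = nth 0 globs k, g' 22 = 0 /\ g' 29 = g 29,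
       m' = mm, x' = x & y' = y]) g mm x y.
Proof.
move=> hg e31.
have b1 := sM_le; have b2 := s_le; have b3 := sW_le; have b4 := L_le; have b5 := n_le.
have b6 := H_le; have b8 := ib_le; have b11 : s * V = s * W + s by rewrite V_def mulnDr muln1.
have e0 := hg 0 isT; have e1 := hg 1 isT; have e2 := hg 2 isT; have e3 := hg 3 isT.
have e4 := hg 4 isT; rewrite /= in e0 e1 e2 e3 e4.
have b9 : M %/ 4 <= M by apply: leq_div.
have b13 : W <= M by rewrite W_def.
have b12 : 2 * (L + 2) %/ M <= 2 * (L + 2) by apply: leq_div.
rewrite /setup_params; op; op; rewrite addn0 -L_def; apply: wp_const => //; first ov.
op; op; op; op; rewrite -s_def; apply: wp_const => //; first ov.
op; rewrite -W_def; op; op; op; rewrite -V_def; op; op; op; op; rewrite -H_def; op.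
rewrite -ib_def; op; op; op; rewrite -kb_def; apply: wp_const => //; first ov.
op; apply: wp_const => //; first ov.
apply: wp_skip; split=> //.
move=> k; do 10 (case: k => [|k]; first by rewrite /upd /= hg).
by do 12 (case: k => [|k]; first by []).
Qed.


Lemma load_a_ok g y : (forall k, k < 22 -> g k = nth 0 globs k) ->
  wp w load_a (10 + nn * 6) (fun g' m' x' y' =>
    [/\ forall k, k < 30 -> g' k = g k,
        forall c, m' c = nth 0 xa c, x' = xb & y' = y])
    g (fun=> 0) (xa ++ xb) y.
Proof.
move=> hg; have b5 := n_le; have b7 := nm_le.
have e1 := hg 1 isT; have e2 := hg 2 isT; have e4 := hg 4 isT; rewrite /= in e1 e2 e4.
rewrite /load_a; apply: wp_const => //; first ov.
op; apply: (wp_cseqs (t1 := n * m * 5 + 2)); first ov.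
apply: (wp_while (N := n * m) (tb := 3) (Inv := fun t g' m' x' y' =>
    [/\ forall k, k < 30 -> g' k = g k, g' 30 = t /\ g' 31 = n * m,
      forall c, m' c = if c < t then nth 0 xa c else 0, x' = drop t xa ++ xb & y' = y])).
- by split=> //; [frame|rewrite drop0].
- move=> t g1 m1 x1 y1 ht [hfr [h30 h31] hm -> ->]; rewrite h30 h31; split=> //.
  have f4 := hfr 4 isT; rewrite e4 in f4; have hx := xa_le t.
  apply: wp_read; [by rewrite (drop_nth 0) ?sz_xa|ov|by []|].
  eapply wp_set; [reflexivity|reflexivity|by []|]; op; apply: wp_skip; split=> //.
  + by frame.
  + by split=> //; rewrite /upd /=; ov.
  + move=> c; rewrite /upd /= h30 hm ltnS; case: eqP => [->|/eqP/negbTE ne]; first by rewrite leqnn.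
    by rewrite [c <= t]leq_eqVlt ne.
- move=> g1 m1 x1 y1 [hfr [h30 h31] hm -> ->]; rewrite h30 h31; split=> //.
  apply: wp_skip; split=> //; last by rewrite -sz_xa drop_size.
  by move=> c; rewrite hm; case: ltnP => // h; rewrite nth_default ?sz_xa.
Qed.

Lemma load_b_ok g mm y : (forall k, k < 22 -> g k = nth 0 globs k) ->
  (forall c, mm c = nth 0 xa c) ->
  wp w load_b (10 + nn * 7) (fun g' m' x' y' =>
    [/\ forall k, k < 30 -> g' k = g k, mem_ab m',
        forall c, nn + nn <= c -> m' c = 0, x' = [::] & y' = y])
    g mm xb y.
Proof.
move=> hg hmm; have b5 := n_le; have b7 := nm_le; have mnC := mulnC m n.
have e1 := hg 1 isT; have e2 := hg 2 isT; have e4 := hg 4 isT; have e5 := hg 5 isT.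
rewrite /= in e1 e2 e4 e5.
rewrite /load_b; apply: wp_const => //; first ov.
op; apply: (wp_cseqs (t1 := n * m * 6 + 2)); first ov.
apply: (wp_while (N := n * m) (tb := 4) (Inv := fun t g' m' x' y' =>
    [/\ forall k, k < 30 -> g' k = g k, g' 30 = t /\ g' 31 = n * m,
      (forall c, c < nn -> m' c = nth 0 xa c) /\
      (forall c, m' (nn + c) = if c < t then nth 0 xb c else 0),
      x' = drop t xb & y' = y])).
- split=> //; [by frame| |by rewrite drop0].
  by split=> // c; rewrite hmm nth_default // sz_xa; ov.
- move=> t g1 m1 x1 y1 ht [hfr [h30 h31] [hm1 hm2] -> ->]; rewrite h30 h31; split=> //.
  have f4 := hfr 4 isT; rewrite e4 in f4; have hx := xb_le t.
  have f5 := hfr 5 isT; rewrite e5 in f5.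
  apply: wp_read; [by rewrite (drop_nth 0) ?sz_xb ?mnC|ov|by []|].
  op; eapply wp_set; [reflexivity|reflexivity|by []|]; op; apply: wp_skip; split=> //.
  + by frame.
  + by split=> //; rewrite /upd /=; ov.
  + split=> [c hc|c]; rewrite /upd /=; first by rewrite ifN ?hm1 //; ov.
    rewrite eqn_add2l hm2 ltnS; case: eqP => [->|/eqP/negbTE ne]; first by rewrite leqnn.
    by rewrite [c <= t]leq_eqVlt ne.
- move=> g1 m1 x1 y1 [hfr [h30 h31] [hm1 hm2] -> ->]; rewrite h30 h31; split=> //.
  apply: wp_skip; split=> //; last by rewrite -mnC -sz_xb drop_size.
  + split=> t ht; first by rewrite hm1 //; ov.
    by rewrite hm2 ht.
  + move=> c hc; have -> : c = nn + (c - nn) by ov.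
    by rewrite hm2 ifN //; ov.
Qed.

Lemma init_c_ok g mm x y : (forall k, k < 22 -> g k = nth 0 globs k) -> mem_ab mm ->
  (forall c, nn + nn <= c -> mm c = 0) ->
  wp w init_c (10 + nn * 6) (fun g' m' x' y' =>
    [/\ forall k, k < 30 -> g' k = g k, memok (fun _ _ => False) m',
        forall c, nn + nn + nn <= c -> m' c = 0, x' = x & y' = y])
    g mm x y.
Proof.
move=> hg hab hz; have b5 := n_le; have b7 := nm_le.
have e3 := hg 3 isT; have e4 := hg 4 isT; have e5 := hg 5 isT; have e6 := hg 6 isT.
rewrite /= in e3 e4 e5 e6.
rewrite /init_c; apply: wp_const => //; first ov.
op; apply: (wp_cseqs (t1 := nn * 5 + 2)); first ov.
apply: (wp_while (N := nn) (tb := 3) (Inv := fun t g' m' x' y' =>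
    [/\ forall k, k < 30 -> g' k = g k, g' 30 = t /\ g' 32 = M + M,
      (forall c, c < nn + nn \/ nn + nn + nn <= c -> m' c = mm c) /\
      (forall c, c < t -> m' (nn + nn + c) = M + M),
      x' = x & y' = y])).
- by split=> //; frame.
- move=> t g1 m1 x1 y1 ht [hfr [h30 h32] [hm1 hm2] -> ->].
  rewrite h30 hfr // e5; split=> //.
  have f4 := hfr 4 isT; rewrite e4 in f4; have f6 := hfr 6 isT; rewrite e6 in f6.
  op; put (nn + nn + t) (M + M) => //; op; apply: wp_skip; split=> //.
  + by frame.
  + by split=> //; rewrite /upd /=; ov.
  + split=> [c hc|c hc]; rewrite /upd /=; first by rewrite ifN ?hm1 //; ov.
    by rewrite eqn_add2l; case: eqP => // ne; rewrite hm2 //; ov.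
- move=> g1 m1 x1 y1 [hfr [h30 h32] [hm1 hm2] -> ->]; rewrite h30 hfr // e5; split=> //.
  apply: wp_skip; split=> //; last by move=> c hc; rewrite hm1 ?hz //; ov.
  split=> //.
  + by case: hab => hA hB; split=> c hc; rewrite hm1; [exact: hA|ov|exact: hB|ov].
  (* Every inner index is a witness for [M + M]; index 0 exists since [m] is positive. *)
  + move=> t ht; exists 0 => //; rewrite hm2 //.
    by rewrite leq_add // ?xa_le ?xb_le.
Qed.

Lemma write_c_ok g mm x : (forall k, k < 22 -> g k = nth 0 globs k) ->
  wp w write_c (10 + nn * 7) (fun g' m' x' y' => y' = mkseq (fun t => mm (nn + nn + t)) nn)
    g mm x [::].
Proof.
move=> hg; have b5 := n_le.
have e4 := hg 4 isT; have e5 := hg 5 isT; have e6 := hg 6 isT; rewrite /= in e4 e5 e6.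
rewrite /write_c; apply: wp_const => //; first ov.
apply: (wp_cseqs (t1 := nn * 6 + 2)); first ov.
apply: (wp_while (N := nn) (tb := 4) (Inv := fun t g' m' x' y' =>
    [/\ forall k, k < 30 -> g' k = g k, g' 30 = t, m' = mm &
       y' = mkseq (fun t => mm (nn + nn + t)) t])).
- by split=> //; frame.
- move=> t g1 m1 x1 y1 ht [hfr h30 -> ->]; rewrite h30 hfr // e5; split=> //.
  have f4 := hfr 4 isT; rewrite e4 in f4; have f6 := hfr 6 isT; rewrite e6 in f6.
  op; get (mm (nn + nn + t)) (by []).
  apply: wp_write => //; op; apply: wp_skip; split=> //.
  + by frame.
  + by rewrite /upd /=; ov.
  + by rewrite mkseqS.
- move=> g1 m1 x1 y1 [hfr h30 _ ->]; rewrite h30 hfr // e5; split=> //.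
  exact: wp_skip.
Qed.

(** * A single run *)

Lemma runs_bounds r : r < 2048 * CB ->
  [/\ rI r * ib <= 2 * n, rJ r * ib <= 2 * n, rK r * kb <= 2 * CB * nn &
   [/\ s * V * rA r <= 3 * (s * V), s * V * rB r <= 3 * (s * V), rA r + rB r <= 6 &
     (rA r + rB r) * V <= 6 * V]].
Proof.
move=> hr; have b8 := ib_le; have b9 := kb_le; have b5 := n_le.
have hmul a b c : a <= b -> a * c <= b * c by move=> h; rewrite leq_mul2r h orbT.
have lmod a b : 0 < b -> a %% b <= b.-1 by move=> h; rewrite -ltnS prednK // ltn_mod.
have h1 := hmul _ _ ib (lmod (r %/ 4 %/ 4) 8 isT).
have h2 := hmul _ _ ib (lmod (r %/ 4 %/ 4 %/ 8) 8 isT).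
have h3 := hmul _ _ (s * V) (lmod r 4 isT).
have h4 := hmul _ _ (s * V) (lmod (r %/ 4) 4 isT).
have h5 := lmod r 4 isT; have h6 := lmod (r %/ 4) 4 isT.
have h7 : rA r + rB r <= 6 by rewrite /rA /rB; ov.
have h8 : rK r <= 2 * CB.
  by rewrite /rK -!divnMA ltnW // ltn_divLR //; ov.
split; [rewrite /rI; ov|rewrite /rJ; ov| |split].
- by apply: leq_mul => //; ov.
- by rewrite mulnC.
- by rewrite mulnC.
- exact: h7.
- exact: hmul.
Qed.

Lemma setup_run_ok r g mm x y : (forall k, k < 22 -> g k = nth 0 globs k) -> g 22 = r ->
  g 29 = pbase r -> r < 2048 * CB ->
  wp w setup_run 20 (fun g' m' x' y' =>
    [/\ forall k, k < 30 -> g' k = nth 0 (globs ++ runs r) k, m' = mm, x' = x & y' = y]) g mm x y.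
Proof.
move=> hg e22 e29 hr.
have b1 := sM_le; have b2 := s_le; have b3 := sW_le; have b4 := L_le; have b5 := n_le.
have b8 := ib_le; have b11 : s * V <= s * W + s by rewrite V_def mulnDr muln1.
have b13 : V <= M + 1 by rewrite V_def W_def leq_add2r; apply: leq_div.
have e15 := hg 15 isT; have e17 := hg 17 isT; have e19 := hg 19 isT; have e20 := hg 20 isT.
rewrite /= in e15 e17 e19 e20.
have [c1 c2 c3 [c4 c5 c6 c7]] := runs_bounds hr.
rewrite /rA /rB /rI /rJ /rK in c1 c2 c3 c4 c5 c6 c7.
have hrw : r < 2 ^ w.
  have w0 : 0 < 2 ^ v by rewrite expn_gt0.
  apply: leq_trans hr _; apply: leq_trans (ltnW cap3); apply: leq_trans (leq_addl _ _).
  exact: leq_trans (leq_addr 2 _) (leq_pmulr _ w0).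
have d1 := leq_div r 4; have d2 := leq_div (r %/ 4) 4; have d3 := leq_div (r %/ 4 %/ 4) 8.
have d4 := leq_div (r %/ 4 %/ 4 %/ 8) 8.
rewrite /setup_run; apply: wp_const => //; first ov.
op; op; op; op; apply: wp_const => //; first ov.
op; op; op; op; op; op; op; op; op; op; op.
apply: wp_skip; split=> //.
move=> k; do 22 (case: k => [|k]; first by rewrite /upd /= hg).
do 8 (case: k => [|k]; first by rewrite /upd /= ?e22 ?e29; move=> _; reflexivity).
by [].
Qed.


Section Runs.
Variables (R : realType) (f : nat -> R) (P : program) (T : nat).
Hypothesis (f_le : forall d : nat, L <= d -> (M%:R * f d <= d%:R)%R).
Hypothesis (apsp : forall e : rel 'I_n, exists D' : 'I_n -> 'I_n -> option nat,
  (forall u v, exists2 D, is_dist e u v D & additive_approx f D (D' u v)) /\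
  computes_within v P (graph_input e) T (row_major (fun u v => dist_word (D' u v)))).

(** Entry [t] lies in the blocks of run [r], [kk] has a complete path in its graph, and the
    remainders [la] and [lb] place both summands in the classes of the run. *)
Definition covers r t kk : Prop := exists u q k la lb,
  [/\ u < ib, q < ib, t = dec_tgt (rI r * ib) (rJ r * ib) (u * ib + q),
      kk = (rK r * kb + k) %% m & 0 < M] /\
  [/\ ib + ib + k.+1 * H <= n, la <= W, lb <= W,
      ma ((rI r * ib + u) %% n) kk = la + V * rA r &
      mb kk ((rJ r * ib + q) %% n) = lb + V * rB r].

(** By the choice of [s], [L + 2] is less than half of [s * M]; since [W] is at most [M / 4], the
    other two terms fit into the other half. *)
Lemma params_fit : 0 < M -> L + 2 + s * W + s * W < s * M.
Proof.
move=> M0; have h1 := sW_le.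
have h2 : 2 * (L + 2) < s * M by rewrite s_def addn1 mulSn addnC -ltn_divLR.
by ov.
Qed.

Lemma tri_dec_tgt i0 j0 u q kk : 0 < ib -> q < ib ->
  tri (dec_tgt i0 j0 (u * ib + q)) kk = ma ((i0 + u) %% n) kk + mb kk ((j0 + q) %% n).
Proof.
move=> ib0 hq; have eu : (u * ib + q) %/ ib = u by rewrite divnMDl // divn_small // addn0.
have eq : (u * ib + q) %% ib = q by rewrite modnMDl modn_small.
rewrite /tri /dec_tgt eu eq.
have h z : z %% n < n by rewrite ltn_mod n_gt0.
by rewrite divnMDl ?n_gt0 // divn_small // addn0 modnMDl (modn_small (h _)).
Qed.

(** Soundness holds for every decoded pair, so no update is wrong; completeness is claimed for
    covered indices only. Memory from [pbase r.+1] on stays zero for the next run. *)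
Lemma run_ok S r g mm x y :
  (forall k, k < 22 -> g k = nth 0 globs k) -> g 22 = r -> g 29 = pbase r ->
  r < 2048 * CB -> memok S mm -> (forall c, pbase r <= c -> mm c = 0) ->
  wp w (run P) (60 + nn * 140 + size (prog_regs P) + T * 6) (fun g' m' x' y' =>
    [/\ forall k, k < 22 -> g' k = nth 0 globs k, g' 22 = r.+1 /\ g' 29 = pbase r.+1,
        memok (fun t kk => S t kk \/ covers r t kk) m',
        forall c, pbase r.+1 <= c -> m' c = 0 & y' = y]) g mm x y.
Proof.
move=> hg e22 e29 hr hok hz.
have [c1 c2 c3 [c4 c5 c6 c7]] := runs_bounds hr.
have b8 := ib_le; have b10 := n_gt0.
pose gad := gadget n m ib L s (s * W) H (rI r * ib) (rJ r * ib) (rK r * kb)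
  (s * V * rA r) (s * V * rB r) ma mb.
pose e : rel 'I_n := fun u v => gad u v.
have [D' [hD hcw]] := apsp e; set ys := row_major _ in hcw.
have sys : size ys = nn by rewrite size_row_major.
have pb1 : nn + nn + nn + nn + 1 + nn <= pbase r by apply: leq_addr.
have pb2 : pbase r + mask < 2 ^ w.
  apply: leq_ltn_trans cap3; rewrite /pbase -addnA -mulSnr.
  by apply: leq_add; [ov|rewrite leq_mul2r; apply/orP; right; ov].
have pbS : pbase r.+1 = pbase r + mask by rewrite /pbase mulSnr addnA.
have hrw : r < pbase r.
  have w0 : 0 < mask by rewrite expn_gt0.
  by apply: leq_ltn_trans (leq_pmulr r w0) _; rewrite /pbase; ov.
rewrite /run; apply: (wp_cseqs (t1 := 20)); first ov.
apply: wp_weaken (setup_run_ok _ _ _ hg e22 e29 hr) (leqnn _) _.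
move=> g1 m1 x1 y1 [hg1 -> -> ->].
apply: (wp_cseqs (t1 := 10 + nn * 90)); first ov.
apply: wp_weaken (leqnn _) _.
  apply: (build_ok _ _ c1 c2 c3 c4 c5); try by rewrite hg1.
    by move=> k hk; rewrite hg1 ?nth_cat ?hk //; ov.
  by case: hok.
move=> g2 m2 x2 y2 [hg2 [hn hG] hm2 -> ->].
have {}hg2 k : k < 30 -> g2 k = nth 0 (globs ++ runs r) k by move=> hk; rewrite hg2 ?hg1.
apply: (wp_cseqs (t1 := 2 + size (prog_regs P) + T * 6)); first ov.
apply: wp_weaken (leqnn _) _.
  apply: (simulate_ok x y (xs := graph_input e) (ys := ys) (pb := pbase r)); try by rewrite hg2.
  - exact: pb1.
  - exact: pb2.
  - by rewrite /= size_row_major.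
  - case=> [|t] ht; first by rewrite addn0 hn.
    have htn : t < nn by [].
    have hu : t %/ n < n by rewrite ltn_divLR.
    have hv : t %% n < n by rewrite ltn_mod.
    have := nth_row_major (fun u v : 'I_n => nat_of_bool (e u v)) (Ordinal hu) (Ordinal hv).
    by rewrite /= -divn_eq => ->; rewrite -addn1 (addnC t) addnA hG.
  - by move=> c hc; rewrite hm2 ?hz //; ov.
  - exact: hcw.
  - by rewrite sys.
move=> g3 m3 x3 y3 [hg3 hm3 hys -> ->].
have {}hg3 k : k < 30 -> g3 k = nth 0 (globs ++ runs r) k by move=> hk; rewrite hg3 ?hg2 //; ov.
have cABE : (rA r + rB r) * V = V * rA r + V * rB r by rewrite mulnDl !(mulnC V).
have hsV c : s * V * c = s * (V * c) by rewrite mulnA.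
have src u q (hu : u < n) (hq : ib + q < n) : q < ib ->
    nth 0 ys (dec_src (u * ib + q)) = dist_word (D' (Ordinal hu) (Ordinal hq)).
  move=> hqi; rewrite /dec_src divnMDl ?modnMDl ?(divn_small hqi) ?(modn_small hqi) ?addn0; last ov.
  by rewrite -addnA -(nth_row_major (fun u v => dist_word (D' u v))).
have m0 := m_gt0; have s0 := s_gt0.
apply: (wp_cseqs (t1 := 10 + nn * 50)); first ov.
apply: wp_weaken (leqnn _) _.
  apply: (decode_ok (S := S) (wd := nth 0 ys) _ _ _ _ _ _ c1 c2 c7); try by rewrite hg3.
  - by move=> k hk; rewrite hg3 ?nth_cat ?hk //; ov.
  - move=> i hi; split; first by apply: hys; rewrite sys.
    have [_ <-] := hcw; have /all_nthP := out_lt v P (graph_input e) T; apply.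
    by have [_ ->] := hcw; rewrite sys.
  - move=> z hz'; have ib0 : 0 < ib by case: (ib) hz'.
    have hu : z %/ ib < ib by rewrite ltn_divLR.
    have hq : z %% ib < ib by rewrite ltn_mod.
    have hu' : z %/ ib < n by ov.
    have hq' : ib + z %% ib < n by ov.
    rewrite {1 2 3 4}(divn_eq z ib) (src _ _ hu' hq') //.
    have [D hD1 hD2] := hD (Ordinal hu') (Ordinal hq').
    case ED: (D' _ _) hD2 => [d'|] // hD2 _.
    rewrite /e /gad !hsV in hD1.
    have hq2 : ib <= (Ordinal hq' : nat) < ib + ib by rewrite /= leq_addr ltn_add2l.
    have [h1 [kk h2 h3]] := gadget_decode_sound m0 s0 H_def (u := Ordinal hu') hu hq2 hD1 hD2.
    rewrite /dist_word; split; first by ov.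
    exists kk => //; rewrite tri_dec_tgt // cABE; rewrite /= addKn in h3.
    by have -> : d'.+1 - (L + 3) = d' - (L + 2) by ov.
  - apply: memok_frame hok => c hc; rewrite hm3; last by left; ov.
    by rewrite hm2 //; left.
move=> g4 m4 x4 y4 [hg4 hok4 hm4 -> ->].
have f4 := hg4 4 isT; have f10 := hg4 10 isT; have f22 := hg4 22 isT; have f29 := hg4 29 isT.
rewrite hg3 //= in f4; rewrite hg3 //= in f10; rewrite hg3 //= in f22; rewrite hg3 //= in f29.
apply: (wp_cseqs (t1 := 2)); first ov.
op; op; do 2 apply: wp_skip; split=> //.
- by fr; move=> k hk; rewrite hg4 ?hg3 ?nth_cat ?hk //; ov.
- by split; rewrite /upd /= ?pbS //; ov.
- case: hok4 => k1 k2 k3; split=> // t kk ht [hs|hc]; apply: k3 => //; first by left.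
  right; case: hc => u [q [k [la [lb [[hu hq tE kkE M0] [hk hla hlb ea eb]]]]]].
  have ib0 : 0 < ib by ov.
  have hu' : u < n by ov.
  have hq' : ib + q < n by ov.
  have [D hD1 hD2] := hD (Ordinal hu') (Ordinal hq').
  rewrite /e /gad !hsV in hD1; rewrite kkE in ea eb.
  have hq2 : ib <= (Ordinal hq' : nat) < ib + ib by rewrite /= leq_addr ltn_add2l.
  have [| |d' Ed' hd'] := gadget_decode_complete m0 s0 H_def (u := Ordinal hu') hu hq2 hD1
    hD2 M0 f_le (params_fit M0) hk hla hlb.
  + exact: ea.
  + by rewrite /= addKn.
  exists (u * ib + q); first exact: idx_lt.
  rewrite (src _ _ hu' hq') // Ed' /=; split=> //.
  rewrite tE tri_dec_tgt // cABE kkE; rewrite /= addKn in hd'.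
  by have -> : d'.+1 - (L + 3) = d' - (L + 2) by ov.
- move=> c; rewrite pbS => hc; rewrite hm4 ?hm3 ?hm2 ?hz //; ov.
Qed.

(** Blocks of [ib] rows or columns, classes of [V] values and groups of [kb] inner indices are
    numerous enough to exhaust everything; the run number is assembled from the quotients. *)
Lemma covers_all K0 t kk : CB = K0 + 14 -> M <= K0 * L -> 0 < M -> CB <= kk < m -> t < nn ->
  exists2 r, r < 2048 * CB & covers r t kk.
Proof.
move=> CBE hM M0 /andP[hkk1 hkk2] ht.
have b8 := ib_le; have b6 := H_le; have b10 := n_gt0.
have hib : ib + ib <= n by ov.
have ibn : n < 4 * ib.+1 by rewrite mulnC -ltn_divLR // -ib_def.
have Hgt : 0 < H by rewrite H_def addn1.
have Lm : L * m <= n by rewrite L_def leq_trunc_div.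
have kbH : kb * H <= n - (ib + ib) by rewrite kb_def leq_trunc_div.
have kbn : n - (ib + ib) < kb.+1 * H by rewrite -ltn_divLR // -kb_def.
(* From [2 * H <= 4 * L + M + 10], [M <= K0 * L] and [0 < L] follows [2 * H <= (K0 + 14) * L], which
   explains [CB]. At least half of the vertices remain for the paths. *)
have Hm : H * m <= CB * (n - (ib + ib)).
  have h1 : 2 * H <= CB * L.
    by rewrite CBE mulnDl; apply: leq_trans b6 _; have := L_gt0; ov.
  have h2 : 2 * H * m <= CB * n.
    apply: leq_trans (_ : CB * L * m <= _); first by rewrite leq_mul2r h1 orbT.
    by rewrite -mulnA leq_mul2l Lm orbT.
  rewrite -(leq_pmul2l (m := 2)) // mulnA; apply: leq_trans h2 _.
  by rewrite mulnCA leq_mul2l; apply/orP; right; ov.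
have mkb : m < CB * kb.+1.
  rewrite -(ltn_pmul2l Hgt); apply: leq_ltn_trans Hm _.
  have -> : H * (CB * kb.+1) = CB * (kb.+1 * H) by rewrite mulnCA [H * _]mulnC.
  by rewrite ltn_pmul2l // CBE addnC.
(* If no path fits, then [m < CB] and no index is left to cover. *)
have kb0 : 0 < kb.
  by case: (kb) mkb => //; rewrite muln1 => h; have := leq_ltn_trans hkk1 hkk2; rewrite ltnNge ltnW.
have kkb : kk %/ kb < 2 * CB.
  rewrite ltn_divLR //; apply: leq_trans hkk2 _; apply: leq_trans (ltnW mkb) _.
  by rewrite -mulnA mulnCA leq_mul2l; apply/orP; right; ov.
have hu : t %/ n < n by rewrite ltn_divLR.
have hq : t %% n < n by rewrite ltn_mod.
(* Here [n >= m > CB >= 14], so a quarter of [n] is positive, and rounding it down at most doubles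
   the number of blocks. *)
have ib0 : 0 < ib by ov.
have n8 : n <= 8 * ib by ov.
pose i := t %/ n; pose j := t %% n.
have hbi : i %/ ib < 8 by rewrite ltn_divLR // (leq_trans hu).
have hbj : j %/ ib < 8 by rewrite ltn_divLR // (leq_trans hq).
have V0 : 0 < V by rewrite V_def addn1.
have M4V : M < 4 * V by rewrite V_def W_def addn1 mulnC -ltn_divLR.
have hA : ma i kk %/ V < 4 by rewrite ltn_divLR // (leq_ltn_trans (xa_le _)).
have hB : mb kk j %/ V < 4 by rewrite ltn_divLR // (leq_ltn_trans (xb_le _)).
have hla z : z %% V <= W by rewrite -ltnS -(addn1 W) -V_def ltn_mod.
(* The digits in the order in which [setup_run] extracts them, lowest last. *)
pose r := (((kk %/ kb * 8 + j %/ ib) * 8 + i %/ ib) * 4 + mb kk j %/ V) * 4 + ma i kk %/ V.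
have dm a b c : b < c -> (a * c + b) %/ c = a /\ (a * c + b) %% c = b.
  move=> h; have c0 : 0 < c by apply: leq_ltn_trans h.
  by rewrite divnMDl // divn_small // addn0 modnMDl modn_small.
have [r1 r2] := dm _ _ _ hA : r %/ 4 = _ /\ rA r = _.
have [r3 r4] := dm ((kk %/ kb * 8 + j %/ ib) * 8 + i %/ ib) _ _ hB.
have [r5 r6] := dm (kk %/ kb * 8 + j %/ ib) _ _ hbi.
have [r7 r8] := dm (kk %/ kb) _ _ hbj.
have rBE : rB r = mb kk j %/ V by rewrite /rB r1 r4.
have rIE : rI r = i %/ ib by rewrite /rI r1 r3 r6.
have rJE : rJ r = j %/ ib by rewrite /rJ r1 r3 r5 r8.
have rKE : rK r = kk %/ kb by rewrite /rK r1 r3 r5 r7.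
exists r.
  have := idx_lt (idx_lt (idx_lt (idx_lt kkb hbj) hbi) hB) hA.
  by rewrite -/r -!mulnA (mulnC 2) -!mulnA [X in _ < X -> _]mulnC.
exists (i %% ib), (j %% ib), (kk %% kb), (ma i kk %% V), (mb kk j %% V).
have ltib z : z %% ib < ib by rewrite ltn_mod.
have hi : (i %/ ib * ib + i %% ib) %% n = i by rewrite -divn_eq modn_small.
have hj : (j %/ ib * ib + j %% ib) %% n = j by rewrite -divn_eq modn_small.
rewrite rIE rJE rKE r2 rBE; split.
- split=> //; last by rewrite -divn_eq modn_small.
  have [d1 d2] := dm (i %% ib) _ _ (ltib j).
  by rewrite /dec_tgt d1 d2 hi hj -divn_eq.
- rewrite hi hj; split; [|exact: hla|exact: hla| |]; try by rewrite addnC mulnC -divn_eq.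
  rewrite -[X in _ <= X](subnKC hib) leq_add2l; apply: leq_trans kbH.
  by rewrite leq_mul2r ltn_mod kb0 orbT.
Qed.

Definition total_time : nat :=
  (20 + nn * 3) + ((10 + kap * 5) + (30 + ((10 + nn * 6) + ((10 + nn * 7) + ((10 + nn * 6) +
  ((10 + CB * nn * 30) +
   ((2048 * CB * (60 + nn * 140 + size (prog_regs P) + T * 6).+2 + 2) +
    ((10 + nn * 7) + 0)))))))).

Lemma minplus_code_ok K0 lam : CB = K0 + 14 -> M <= K0 * L ->
  v = kap * lam -> n < 2 ^ lam -> (forall k, k < lam -> 2 ^ k <= n) -> lam <= n ->
  wp w (minplus_code P kap CB) total_time (fun g' m' x' y' =>
    exists2 c : nat -> nat, y' = mkseq c nn & forall t, t < nn ->
      (exists2 kk, kk < m & tri t kk <= c t) /\ (forall kk, kk < m -> c t <= tri t kk))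
    (fun=> 0) (fun=> 0) [:: n, m, n, M & xa ++ xb] [::].
Proof.
move=> CBE hM hv hl1 hl2 hl3; have CB0 : 0 < CB by rewrite CBE addnC.
rewrite /minplus_code /total_time.
apply: wp_cons; apply: wp_weaken (setup_regs_ok _ _ hl1 hl2 hl3) (leqnn _) _.
move=> g1 m1 x1 y1 [h1 h10 h29 -> [-> ->]].
apply: wp_cons; apply: wp_weaken (setup_mask_ok _ _ _ hv (h1 4 isT) h10) (leqnn _) _.
move=> g2 m2 x2 y2 [k1 k31 -> -> ->].
have k2 k : k < 10 -> g2 k = nth 0 globs k by move=> hk; rewrite k1 ?h1 //; ov.
apply: wp_cons; apply: wp_weaken (setup_params_ok _ _ _ k2 k31) (leqnn _) _.
move=> g3 m3 x3 y3 [hg [h22 h29'] -> -> ->].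
rewrite k1 // h29 in h29'.
pose ok (g : nat -> nat) := (forall k, k < 22 -> g k = nth 0 globs k) /\ g 22 = 0 /\ g 29 = pbase 0.
have okS g g' : ok g -> (forall k, k < 30 -> g' k = g k) -> ok g'.
  by move=> [o1 [o2 o3]] e; split; [move=> k hk; rewrite e ?o1 //; ov|rewrite !e].
have {hg h22 h29'} ok3 : ok g3 by [].
apply: wp_cons; apply: wp_weaken (load_a_ok _ (proj1 ok3)) (leqnn _) _.
move=> g4 m4 x4 y4 [/(okS _ _ ok3) ok4 hm4 -> ->].
apply: wp_cons; apply: wp_weaken (load_b_ok _ (proj1 ok4) hm4) (leqnn _) _.
move=> g5 m5 x5 y5 [/(okS _ _ ok4) ok5 hab hz5 -> ->].
apply: wp_cons; apply: wp_weaken (init_c_ok _ _ (proj1 ok5) hab hz5) (leqnn _) _.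
move=> g6 m6 x6 y6 [/(okS _ _ ok5) ok6 hok6 hz6 -> ->].
apply: wp_cons; apply: wp_weaken (brute_ok _ _ CB0 (proj1 ok6) hok6) (leqnn _) _.
move=> g7 m7 x7 y7 [/(okS _ _ ok6) [hg7 [h22 h29']] hok7 hz7 -> ->].
apply: wp_cons.
apply: (wp_while (Inv := fun r g' m' x' y' =>
    [/\ forall k, k < 22 -> g' k = nth 0 globs k, g' 22 = r /\ g' 29 = pbase r,
        memok (fun t kk => (kk < m /\ kk < CB) \/ exists2 r', r' < r & covers r' t kk) m',
        forall c, pbase r <= c -> m' c = 0 & y' = [::]])).
- split=> //.
    by case: hok7 => o1 o2 o3; split=> // t kk ht [|[]//]; apply: o3.
  by move=> c hc; rewrite hz7 ?hz6 //; rewrite /pbase in hc; ov.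
- move=> r g8 m8 x8 y8 hr [hg8 [o22 o29] hok8 hz8 ->].
  rewrite o22 (hg8 9 isT); split=> //.
  apply: wp_weaken (run_ok _ _ hg8 o22 o29 hr hok8 hz8) (leqnn _) _.
  move=> g9 m9 x9 y9 [p1 p2 [p3 p4 p5] p6 p7]; split=> //; split=> // t kk ht hS.
  apply: p5 => //; case: hS => [|[r' hr' hc]]; first by left; left.
  have [e|ne] := eqVneq r' r; first by right; rewrite -e.
  by left; right; exists r' => //; ov.
- move=> g8 m8 x8 y8 [hg8 [o22 o29] [o1 o2 o3] hz8 ->].
  rewrite o22 (hg8 9 isT); split=> //.
  apply: wp_cons; apply: wp_weaken (write_c_ok _ _ hg8) (leqnn _) _.
  move=> g9 m9 x9 y9 ->; apply: wp_skip; exists (fun t => m8 (nn + nn + t)) => // t ht.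
  split; first exact: o2.
  move=> kk hkk; have [lt|ge] := ltnP kk CB; first by apply: o3 => //; left.
  (* For [M = 0] no run covers anything, but all sums are 0 and index 0, treated by [brute], attains
     the minimum. *)
  have [M0|M0] := posnP M.
    have h0 : tri t 0 = 0.
      by apply/eqP; rewrite addn_eq0 -!leqn0 -M0 xa_le xb_le.
    by apply: leq_trans (o3 t 0 ht _) _; rewrite ?h0 //; left.
  by apply: o3 => //; right; apply: covers_all hM M0 _ ht => //; rewrite ge.
Qed.

End Runs.
End Program.

(** * The running time *)

(** Control past the end is a fixed state, so a larger time bound is harmless. *)
Lemma wp_computes w (c : code) t t' x (Q : seq nat -> Prop) : t <= t' ->
  wp w c t (fun _ _ _ y' => Q y') (fun=> 0) (fun=> 0) x [::] ->
  exists2 y, Q y & computes_within w (c 0) x t' y.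
Proof.
move=> le H; have [|u [g [m [x' [y [lu eu q]]]]]] := H (c 0) 0.
  by exists [::], [::]; rewrite cats0.
exists y => //; rewrite /computes_within.
have -> : iter t' (step w (c 0)) (init x) = State (size (c 0)) g m x' y.
  rewrite -(subnK (leq_trans lu le)) iterD eu; elim: (t' - u) => //= k ->.
  by rewrite /step /= onth_default.
by split.
Qed.

(** All terms are constants times 1, [nn] or [T], and [nn <= T]; 208 is 60 + 2 + 140 + 6. *)
Lemma total_time_le nn kap CB r sz T : 0 < nn -> nn <= T ->
  (20 + nn * 3) + ((10 + kap * 5) + (30 + ((10 + nn * 6) + ((10 + nn * 7) + ((10 + nn * 6) +
  ((10 + CB * nn * 30) +
   ((r * (60 + nn * 140 + sz + T * 6).+2 + 2) +
    ((10 + nn * 7) + 0)))))))) <=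
  (200 + 5 * kap + 30 * CB + r * (208 + sz)) * T.
Proof.
move=> nn0 nnT; have T0 : 0 < T by lia.
have h1 : CB * nn <= CB * T by rewrite leq_mul2l nnT orbT.
have h2 : kap <= kap * T by rewrite leq_pmulr.
have h3 : sz <= sz * T by rewrite leq_pmulr.
have h4 : r * (60 + nn * 140 + sz + T * 6).+2 <= r * (208 + sz) * T.
  by rewrite -mulnA leq_mul2l mulnDl; apply/orP; right; lia.
have hD a b c d : (a + b + c + d) * T = a * T + b * T + c * T + d * T by rewrite !mulnDl.
rewrite hD; move: (r * _ * T) (r * _) h4 => a b h4.
by rewrite -[5 * kap * T]mulnA -[30 * CB * T]mulnA; lia.
Qed.

(** With [X = 2 ^ mu], the factor [X ^ kap] of [2 ^ w] takes care of the simulated word, [X ^ 2] of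
    [n * n] and [M], and [X ^ e > e] of all constants. *)
Lemma word_capacity kap CB n M lam mu : n < 2 ^ mu -> M < 2 ^ mu -> lam <= mu -> 0 < mu ->
  let w := (kap + 2 + (4096 * CB.+1 + kap)) * mu in let v := kap * lam in
  [/\ v < w, 100 * (n * n + M + 1) + 2 ^ v < 2 ^ w, 100 * (CB + 1) * (n * n) < 2 ^ w,
      5 * (n * n) + 1 + (2048 * CB + 2) * 2 ^ v < 2 ^ w & kap < 2 ^ w].
Proof.
move=> hn hM hl hmu w v.
set e := 4096 * CB.+1 + kap in w *.
have hv : v <= kap * mu by rewrite leq_mul2l hl orbT.
set X := 2 ^ mu in hn hM.
have X0 : 0 < X by rewrite expn_gt0.
have hmask : 2 ^ v <= X ^ kap by rewrite -expnM leq_exp2l // mulnC.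
have wE : 2 ^ w = X ^ kap * X ^ 2 * X ^ e by rewrite -!expnD -expnM mulnC.
set Y := X ^ kap in hmask wE; have Y0 : 0 < Y by rewrite expn_gt0 X0.
have hE : e < X ^ e.
  apply: leq_trans (ltn_expl e (isT : 1 < 2)) _; rewrite -expnM leq_exp2l //.
  by rewrite leq_pmull.
have hX : n * n <= X ^ 2 by rewrite -[n * n]/(n ^ 2) leq_exp2r // ltnW.
have hX1 : X <= X ^ 2 by rewrite leq_pmulr.
have hXY : X ^ 2 <= Y * X ^ 2 by rewrite leq_pmull.
have hYX : Y <= Y * X ^ 2 by rewrite leq_pmulr // expn_gt0 X0.
have hb : e * (Y * X ^ 2) < 2 ^ w.
  by rewrite wE mulnC ltn_pmul2l // muln_gt0 Y0 expn_gt0 X0.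
move: (Y * X ^ 2) hXY hYX hb => Z hXY hYX hb.
have Z0 : 0 < Z by apply: leq_trans hYX.
have hc : CB * (n * n) <= CB * Z by rewrite leq_mul2l (leq_trans hX hXY) orbT.
have hd : CB * 2 ^ v <= CB * Z by rewrite leq_mul2l (leq_trans hmask hYX) orbT.
have he a : (a * CB.+1 + kap) * Z = a * (CB * Z) + a * Z + kap * Z.
  by rewrite mulnDl -mulnA mulSn mulnDr (addnC (a * Z)).
have hf : kap <= kap * Z by rewrite leq_pmulr.
rewrite /e he in hb.
split.
- by apply: leq_ltn_trans hv _; rewrite ltn_pmul2r //; move: (e) => e'; lia.
- lia.
- by rewrite -mulnA mulnDl mul1n; lia.
- by rewrite mulnDl -mulnA; lia.
- lia.
Qed.

Theorem theorem17 (R : realType) (f : nat -> R) (T : nat -> nat)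
  (f_gt0 : forall l : nat, (0 < f l)%R)
  (f_away0 : exists2 c : R, (0 < c)%R & forall l : nat, (c <= f l)%R)
  (f_mono : forall l m : nat, (l <= m)%N -> (l%:R / f l <= m%:R / f m)%R)
  (apsp : additive_apsp_in_time f T) :
  exists2 tau : nat -> nat -> nat -> nat -> nat,
    minplus_in_time (tradeoff_family f) tau &
    exists K : nat, forall n : nat, (0 < n)%N ->
      (\max_(1 <= l < n.+1) tau n (n %/ l)%N n (entry_bound f l) <= K * T n)%N.
Proof.
have [c c_gt0 c_le] := f_away0; have [P [kap hP]] := apsp.
(* Since [c <= f l], the entry bound is at most [l / c <= K0 * l]. *)
pose K0 := (Num.truncn c^-1).+1; pose CB := K0 + 14.
pose K := 200 + 5 * kap + 30 * CB + 2048 * CB * (208 + size (prog_regs P)).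
(* The bound does not depend on [l], so the maximum is immediate. *)
exists (fun n _ _ _ => K * T n); last first.
  exists K => n _; apply: (big_ind (fun x => x <= K * T n)) => // x y hx hy.
  by rewrite geq_max hx.
exists (minplus_code P kap CB 0), (kap + 2 + (4096 * CB.+1 + kap)).
move=> n1 n2 n3 M [n [l [/andP[l_gt0 l_le] -> -> -> hM]]] A B leA leB.
set m := n %/ l in A B leA leB *; set L := n %/ m.
have n_gt0 : 0 < n by apply: leq_trans l_le.
have m_gt0 : 0 < m by rewrite divn_gt0.
have m_le : m <= n by apply: leq_div.
(* The program receives [n] and [m] but not [l]; the value [L] it recomputes is at least [l]. *)
have lL : l <= L by rewrite leq_divRL // mulnC leq_trunc_div.
have quot_ge0 : (0 <= l%:R / f l)%R by rewrite divr_ge0 // ltW.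
have M_le : (M%:R <= l%:R / f l)%R by rewrite hM truncn_le.
have MK : M <= K0 * L.
  apply: leq_trans (_ : K0 * l <= _); last by rewrite leq_mul2l lL orbT.
  rewrite -(ler_nat R) natrM; apply: le_trans M_le _; rewrite mulrC.
  apply: ler_wpM2r => //; apply: le_trans (_ : c^-1 <= _)%R.
    by rewrite lef_pV2 ?posrE.
  exact/ltW/truncnS_gt.
(* Monotonicity gives [M <= l / f l <= d / f d]. *)
have f_le d : L <= d -> (M%:R * f d <= d%:R)%R.
  move=> hd; rewrite -ler_pdivlMr //; apply: le_trans M_le _; apply: f_mono.
  exact: leq_trans lL hd.
set N := n + m + n + M; rewrite /wordlen.
pose lam := (trunc_log 2 n).+1; pose mu := (trunc_log 2 N).+1.
have N_lt : N < 2 ^ mu by apply: trunc_log_ltn.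
have [||||vw cap1 cap2 cap3 cap4] := @word_capacity kap CB n M lam mu.
- by apply: leq_ltn_trans N_lt; rewrite /N; lia.
- by apply: leq_ltn_trans N_lt; rewrite /N; lia.
- by rewrite ltnS leq_trunc_log // /N; lia.
- by [].
have nth_le n' m' (F : 'I_n' -> 'I_m' -> nat) :
    (forall i j, F i j <= M) -> forall t, nth 0 (row_major F) t <= M.
  move=> hF t; have [lt|ge] := ltnP t (size (row_major F)); last by rewrite nth_default.
  rewrite size_row_major in lt.
  have m'0 : 0 < m' by case: m' {F hF} lt => //; rewrite muln0.
  have hi : t %/ m' < n' by rewrite ltn_divLR.
  have hj : t %% m' < m' by rewrite ltn_mod.
  by have := nth_row_major F (Ordinal hi) (Ordinal hj); rewrite /= -divn_eq => ->.
(* Already for the graph without edges, [n * n] words have to be written. *)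
have nnT : n * n <= T n.
  have [D' [_ [_ hout]]] := hP n (fun _ _ => false).
  have := size_out_iter (wordlen kap n) P (graph_input (fun _ _ : 'I_n => false)) (T n).
  by rewrite hout size_row_major.
have lam_le : lam <= n.
  exact: leq_trans (ltn_expl _ (isT : 1 < 2)) (trunc_logP (isT : 1 < 2) n_gt0).
have lam_pow k : k < lam -> 2 ^ k <= n.
  rewrite ltnS => hk; apply: leq_trans (trunc_logP (isT : 1 < 2) n_gt0).
  by rewrite leq_exp2l.
have nn_gt0 : 0 < n * n by rewrite muln_gt0 n_gt0.
have ok := minplus_code_ok m_gt0 m_le vw (size_row_major A) (size_row_major B)
  (nth_le _ _ _ leA) (nth_le _ _ _ leB) (erefl L) erefl erefl erefl erefl erefl erefl
  cap1 cap2 cap3 cap4 f_le (hP n) (erefl CB) MK erefl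
  (trunc_log_ltn n (isT : 1 < 2)) lam_pow lam_le.
have [y [cc -> ccP] run] := wp_computes (total_time_le _ _ _ _ nn_gt0 nnT) ok.
have triE (i j : 'I_n) (k : 'I_m) :
    tri n m (row_major A) (row_major B) (i * n + j) k = A i k + B k j.
  rewrite /tri divnMDl // divn_small // addn0 modnMDl modn_small //.
  by rewrite /ma /mb !nth_row_major.
exists (\matrix_(i < n, j < n) cc (i * n + j)%N)%R; split.
  move=> i j; have ht : i * n + j < n * n by apply: idx_lt.
  have [[k hk le1] le2] := ccP _ ht; rewrite mxE; split.
    exists (Ordinal hk); apply/eqP; rewrite -triE eqn_leq le1 andbT; exact: le2.
  by move=> k'; rewrite -triE; apply: le2.
have -> : row_major (\matrix_(i < n, j < n) cc (i * n + j)%N)%R = mkseq cc (n * n).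
  rewrite -row_major_mkseq; congr flatten; apply: eq_map => i; apply: eq_map => j.
  by rewrite mxE.
exact: run.
Qed.
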